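(* Let $I\subseteq(0,\infty)$ be an interval with $\inf I=0$. Let $\lambda=(\lambda_n)_{n\ge1}\in W_0$, put $\Lambda_n:=\lambda_1+\cdots+\lambda_n$, and assume that $\Lambda_n\to\infty$ and that the sequence $(\lambda_n/\Lambda_n)_{n\ge1}$ is nonincreasing with limit $\eta\in[0,1)$. Let $E\colon I\times I\to\mathbb{R}$ be a normalizable quasideviation whose normalization $E^*$ is concave (as a function on $I\times I$), and assume that $\lim_{t\to0^+}E^*(xt,t)=0$ for all $x\in(0,\infty)$. Define $h_E\colon(0,\infty)\to\mathbb{R}$ by $h_E(x):=\lim_{t\to0^+}t^{-1}E^*(xt,t)$. Then the quasideviation mean $\mathscr{D}_E$ is $\lambda$-Hardy if and only if the mapping $x\mapsto h_E(1/x)$ is integrable over $(0,1]$. In this case, $c:=\mathscr{H}_\lambda(\mathscr{D}_E)$ is the unique solution $c\in(0,\infty)$ of the equation $$\int_0^1 h_E\Big(\frac1{cx}\Big)\,dx=0\quad\text{if }\eta=0,\qquad \sum_{k=0}^{\infty}(1-\eta)^k\,h_E\Big(\frac{1}{c(1-\eta)^k}\Big)=0\quad\text{if }\eta\in(0,1).$$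
   Context: $W_n$ is the set of $(\lambda_1,\dots,\lambda_n)\in\mathbb{R}^n$ with all $\lambda_i\ge0$ and $\lambda_1+\cdots+\lambda_n>0$; $W_0$ is the set of real sequences $(\lambda_n)_{n\ge1}$ with $\lambda_1>0$ and $\lambda_n\ge0$ for $n\ge2$. Quasideviation: a function $E\colon I\times I\to\mathbb{R}$ such that (a) for all $x,y\in I$, $\operatorname{sign}E(x,y)=\operatorname{sign}(x-y)$; (b) for every $x\in I$ the map $y\mapsto E(x,y)$ is continuous; (c) for all $x<y$ in $I$ the map $(x,y)\ni t\mapsto E(y,t)/E(x,t)$ is strictly increasing. It is known that for every $n$ and $(x,\lambda)\in I^n\times W_n$ the equation $\lambda_1E(x_1,y)+\cdots+\lambda_nE(x_n,y)=0$ has a unique solution $y\in I$; it is denoted $\mathscr{D}_E(x,\lambda)$ and called the $E$-quasideviation mean of $(x,\lambda)$. $E$ is normalizable if for every $x\in I$ the function $y\mapsto E(x,y)$ is differentiable at $y=x$ and $x\mapsto\partial_2E(x,x)$ is strictly negative and continuous on $I$. The normalization of $E$ is $E^*(x,y):=\dfrac{E(x,y)}{-\partial_2E(y,y)}$ for $x,y\in I$. Under the hypotheses of the claim it is known that the limit defining $h_E(x)$ exists for every $x>0$. (For fixed $x>0$, $E^*(xt,t)$ is defined for all small $t>0$ since $\inf I=0$.) Hardy constant: for a weighted mean $\mathscr{M}$ on $I$ (a function $\bigcup_n I^n\times W_n\to I$) and $\lambda\in W_0$, $\mathscr{H}_\lambda(\mathscr{M})$ is the smallest extended real number $C$ such that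 $\sum_{n=1}^\infty\lambda_n\,\mathscr{M}\big((x_1,\dots,x_n),(\lambda_1,\dots,\lambda_n)\big)\le C\sum_{n=1}^\infty\lambda_nx_n$ for all sequences $(x_n)$ in $I$. $\mathscr{M}$ is $\lambda$-Hardy if $\mathscr{H}_\lambda(\mathscr{M})<\infty$. *)

(* Defs.v *)
From HB Require Import structures.
From mathcomp Require Import all_boot all_order all_algebra.
From mathcomp Require Import all_classical all_reals all_analysis.
Set Implicit Arguments.
Unset Strict Implicit.
Unset Printing Implicit Defensive.
Import Order.TTheory GRing.Theory Num.Theory.
Import numFieldNormedType.Exports.
Local Open Scope classical_set_scope.
Local Open Scope ring_scope.

(* A function on I * I is represented by a total function R -> R -> R, of which
   only the values at points of I matter. *)
Record quasideviation (R : realType) (I : set R) (E : R -> R -> R) : Prop := {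
  quasideviation_sg : forall x y, I x -> I y -> Num.sg (E x y) = Num.sg (x - y);
  quasideviation_continuous : forall x, I x -> {within I, continuous (E x)};
  quasideviation_ratio : forall x y, I x -> I y -> x < y ->
    forall s t, x < s -> s < t -> t < y -> E y s / E x s < E y t / E x t }.

(* The quasideviation mean, with n entries x and n weights lam. *)
Definition quasidev_mean (R : realType) (I : set R) (E : R -> R -> R)
    (n : nat) (x lam : 'I_n -> R) : R :=
  get [set y | I y /\ \sum_(i < n) lam i * E (x i) y = 0].

(* The limit is taken within I, hence it is one-sided if x is an endpoint
   of I: I may contain its supremum. *)
Definition d2_quotient (R : realType) (E : R -> R -> R) (x y : R) : R :=
  (E x y - E x x) / (y - x).

Definition d2_diag (R : realType) (I : set R) (E : R -> R -> R) (x : R) : R :=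
  lim (d2_quotient E x y @[y --> within I x^']).

Record normalizable (R : realType) (I : set R) (E : R -> R -> R) : Prop := {
  normalizable_derivable : forall x, I x ->
    cvg (d2_quotient E x y @[y --> within I x^']);
  normalizable_lt0 : forall x, I x -> d2_diag I E x < 0;
  normalizable_continuous : {within I, continuous (d2_diag I E)} }.

Definition normalization (R : realType) (I : set R) (E : R -> R -> R)
    (x y : R) : R :=
  E x y / (- d2_diag I E y).

Definition concave_on_square (R : realType) (I : set R) (F : R -> R -> R) :=
  @convex_function R (R^o * R^o)%type (I `*` I) (fun p => - F p.1 p.2).

Definition h_fun (R : realType) (I : set R) (E : R -> R -> R) (x : R) : R :=
  lim (t^-1 * normalization I E (x * t) t @[t --> 0^'+]).

(* Sequences are indexed from 0: lam n, x n and partial_weight lam n stand for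
   the terms of index n + 1 of the sequences indexed from 1. *)
Definition W0 (R : realType) (lam : nat -> R) : Prop :=
  0 < lam 0%N /\ forall n, 0 <= lam n.

Definition partial_weight (R : realType) (lam : nat -> R) (n : nat) : R :=
  \sum_(i < n.+1) lam i.

Definition hardy_inequality (R : realType) (I : set R) (lam : nat -> R)
    (M : forall n, ('I_n -> R) -> ('I_n -> R) -> R) (C : \bar R) : Prop :=
  forall x : nat -> R, (forall n, I (x n)) ->
  (\sum_(0 <= n <oo)
      (lam n * M n.+1 (fun i => x (nat_of_ord i))
                      (fun i => lam (nat_of_ord i)))%:E
    <= C * \sum_(0 <= n <oo) (lam n * x n)%:E)%E.

Definition is_hardy_constant (R : realType) (I : set R) (lam : nat -> R)
    (M : forall n, ('I_n -> R) -> ('I_n -> R) -> R) (C : \bar R) : Prop :=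
  hardy_inequality I lam M C /\
  forall C', hardy_inequality I lam M C' -> (C <= C')%E.

Definition is_hardy (R : realType) (I : set R) (lam : nat -> R)
    (M : forall n, ('I_n -> R) -> ('I_n -> R) -> R) : Prop :=
  exists2 C : \bar R, is_hardy_constant I lam M C & (C < +oo)%E.

(* The left endpoint is left out of the integration domain because 1 / (c x) is
   not defined at x = 0. *)
Definition hardy_equation (R : realType) (eta : R) (h : R -> R) (c : R) : Prop :=
  if eta == 0 then
    (\int[lebesgue_measure]_(x in `]0%R, 1%R]) (h (c * x)^-1)%:E = 0)%E
  else
    series (fun k => (1 - eta) ^+ k * h (c * (1 - eta) ^+ k)^-1) @ \oo --> 0.

(* Main.v *)
Require Import Defs.
From HB Require Import structures.
From mathcomp Require Import all_boot all_order all_algebra.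
From mathcomp Require Import all_classical all_reals all_analysis.
From mathcomp Require Import measurable_realfun.
From mathcomp Require Import ring lra.
Set Implicit Arguments.
Unset Strict Implicit.
Unset Printing Implicit Defensive.
Import Order.TTheory GRing.Theory Num.Theory.
Import numFieldNormedType.Exports.
Local Open Scope classical_set_scope.
Local Open Scope ring_scope.

(* Write [F] for the normalization of [E], [L n] for the partial weights and
   [q = 1 - eta].  Since [F] is concave, [F (x t) t / t] decreases in [t], so
   [F u v <= v h (u / v)], where [h] is concave and nondecreasing, vanishes at
   1, and [h x <= x - 1].  Let [T s n] be the sum over [i <= n] of
   [lam i * h (s * L n / L i)].

   Upper bound.  By Kedlaya's inequality, the weighted average [Y] of the first
   [n + 1] means satisfies [\sum_k lam k * h (A k / Y) >= 0], where [A k] is the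
   weighted average of [x 0, ..., x k].  As [L k * A k <= X := L n * A n], this
   gives [T s n >= 0] for [s = X / (L n * Y)].

   Lower bound.  Testing the Hardy inequality on [x i = e / L i], [e -> 0],
   shows that [b] is at most the Hardy constant as soon as [T (1 / b) n > 0]
   for all large [n], because [\sum_n lam n / L n] diverges.

   Finally [T s n / L n <= G s] for a concave nondecreasing [G], which is
   the integral of [h (s / x)] over [(0, 1]] if [eta = 0] and
   [eta * \sum_k q ^ k * h (s / q ^ k)] otherwise; and [T t n > 0] for all
   large [n] if [G s > 0] (or if [G s] diverges) and [s < t].  So the Hardy
   constant is [1 / s], where [s] is the unique zero of [G]. *)

(** * Concave functions on the half-line *)

Definition concave_pos (R : realType) (f : R -> R) : Prop :=
  forall x y t, 0 < x -> 0 < y -> 0 <= t -> t <= 1 ->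
    t * f x + (1 - t) * f y <= f (t * x + (1 - t) * y).

Section ConcavePos.
Variable R : realType.
Implicit Types (f : R -> R) (x y z s : R).

(** The denominators of the chord inequality are cleared, so that the three points may coincide. *)
Lemma concave_pos_chord f x y z : concave_pos f ->
  0 < x -> x <= y -> y <= z ->
  (z - y) * f x + (y - x) * f z <= (z - x) * f y.
Proof.
move=> cf x0 xy yz.
have [xz|] := ltP x z; last first.
  move=> zx; have -> : y = x by apply/le_anti; rewrite xy (le_trans yz).
  have -> : z = x by apply/le_anti; rewrite zx (le_trans xy).
  by rewrite !subrr !mul0r addr0.
have zx0 : 0 < z - x by rewrite subr_gt0.
have t0 : 0 <= (z - y) / (z - x) by rewrite divr_ge0 ?subr_ge0 // ltW.
have t1 : (z - y) / (z - x) <= 1 by rewrite ler_pdivrMr // mul1r lerD2l lerN2.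
have := cf x z _ x0 (lt_trans x0 xz) t0 t1.
have -> : (z - y) / (z - x) * x + (1 - (z - y) / (z - x)) * z = y.
  by field; rewrite gt_eqF.
rewrite -(ler_pM2l zx0); apply: le_trans; rewrite le_eqVlt; apply/orP; left.
by apply/eqP; field; rewrite gt_eqF.
Qed.

(** The slope [m] is the supremum of the chord slopes from [s] to points on its right; each chord
    slope from the left is an upper bound of them. *)
Lemma concave_pos_support f s : concave_pos f -> 0 < s ->
  exists m, forall x, 0 < x -> f x <= f s + m * (x - s).
Proof.
move=> cf s0.
pose S := [set (f x - f s) / (x - s) | x in [set x | s < x]].
have slope x y : 0 < x -> x < s -> s < y ->
    (f y - f s) / (y - s) <= (f s - f x) / (s - x).
  move=> x0 xs sy; have := concave_pos_chord cf x0 (ltW xs) (ltW sy) => c.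
  rewrite ler_pdivrMr ?subr_gt0 // mulrAC ler_pdivlMr ?subr_gt0 //.
  by nra.
have hs : has_sup S.
  split; first by exists ((f (s + 1) - f s) / (s + 1 - s)); exists (s + 1) => //=; lra.
  exists ((f s - f (s / 2)) / (s - s / 2)) => _ [y sy <-].
  by apply: slope => //=; lra.
exists (sup S) => x x0.
have [xs|sx|->] := ltgtP x s.
- rewrite -lerBlDl -ler_ndivlMr ?subr_lt0 //.
  apply: ge_sup; first by case: hs.
  move=> _ [y sy <-].
  have -> : (f x - f s) / (x - s) = (f s - f x) / (s - x).
    by rewrite -mulrNN -invrN !opprB.
  exact: slope.
- rewrite -lerBlDl -ler_pdivrMr ?subr_gt0 //.
  by apply: ub_le_sup; [case: hs|exists x].
- by rewrite subrr mulr0 addr0.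
Qed.

(** A concave function that drops between two points lies below a decreasing line afterwards, hence
    becomes negative far to the right. *)
Lemma concave_pos_nondecreasing f x y : concave_pos f ->
  (forall z, 1 < z -> 0 < f z) -> 0 < x -> x <= y -> f x <= f y.
Proof.
move=> cf pf x0; rewrite le_eqVlt => /predU1P[->//|xy].
rewrite leNgt; apply/negP => fyx.
have d0 : 0 < f x - f y by rewrite subr_gt0.
pose k := `|f y| / (f x - f y).
have k0 : 0 <= k by rewrite divr_ge0 // ltW.
(* The term [(y - x) * k] brings the line through the points at [x] and [y] down by [|f y|]; the
   extra [1] makes its value at [z] strictly negative and gives [1 < z]. *)
pose z := y + 1 + (y - x) * k.
have kz : 0 <= (y - x) * k by rewrite mulr_ge0 // subr_ge0 ltW.
have yz : y <= z by rewrite /z; lra.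
have z1 : 1 < z by rewrite /z; lra.
have := concave_pos_chord cf x0 (ltW xy) yz; have := pf _ z1.
have kE : k * (f x - f y) = `|f y| by rewrite /k divfK // gt_eqF.
have := ler_norm (f y).
move: (f x) (f y) (f z) d0 kE => fx fy fz d0 kE fy_le fz0 c.
have : (y - x) * fz <= (y - x) * fy - (z - y) * (fx - fy) by nra.
have -> : (z - y) * (fx - fy) = (fx - fy) + (y - x) * `|fy|.
  by rewrite /z -kE; ring.
by nra.
Qed.

(** As [f 1 = 0], the quotient [f v / (v - 1)] is nonincreasing for [v > 1], and
    [(s * y - 1) / (y - 1) <= 2 * s] for [y > 2]; smaller [y] are covered by [f (2 * s)]. This
    serves to dominate one dilation of [h] by another. *)
Lemma concave_pos_growth f s y : concave_pos f -> f 1 = 0 ->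
  (forall x z, 0 < x -> x <= z -> f x <= f z) -> 1 <= s -> 0 < y ->
  f (s * y) <= 2 * s * `|f y| + `|f (2 * s)|.
Proof.
move=> cf f1 fnd s1 y0.
have [y2|y2] := leP y 2.
  apply: (@le_trans _ _ `|f (2 * s)|); last by rewrite lerDr mulr_ge0 //; lra.
  apply: le_trans (ler_norm _); apply: fnd; first by nra.
  by nra.
have c : (s * y - 1) * f y >= (y - 1) * f (s * y).
  have := @concave_pos_chord f 1 y (s * y) cf ltr01.
  by rewrite f1 mulr0 add0r; apply; nra.
have fy0 : 0 <= f y by rewrite -f1; apply: fnd; lra.
rewrite ger0_norm //; apply: (@le_trans _ _ (2 * s * f y)); last by rewrite lerDl.
rewrite -(ler_pM2l (_ : 0 < y - 1)); last by lra.
apply: (le_trans c); rewrite -subr_ge0.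
have -> : (y - 1) * (2 * s * f y) - (s * y - 1) * f y =
          (s * (y - 2) + 1) * f y by ring.
by apply: mulr_ge0 => //; nra.
Qed.

(** The zero is the supremum [s] of the points from [a] on where [f < 0]. If [f s < 0], a supporting
    line at [s] keeps [f] negative just after [s]; if [f s > 0], the chord from [a] keeps [f]
    positive just before [s]. *)
Lemma concave_pos_zero f a b : concave_pos f ->
  (forall x y, 0 < x -> x <= y -> f x <= f y) ->
  0 < a -> f a < 0 -> 0 < b -> 0 < f b ->
  exists s, [/\ 0 < s, f s = 0, forall x, 0 < x -> x < s -> f x < 0 &
    forall x, s < x -> 0 < f x].
Proof.
move=> cf fnd a0 fa b0 fb.
have ab : a < b.
  by rewrite ltNge; apply/negP => /(fnd _ _ b0); lra.
pose S := [set x | a <= x /\ f x < 0].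
have Sb x : S x -> x <= b.
  case=> ax fx; rewrite leNgt; apply/negP => bx.
  by have := fnd _ _ b0 (ltW bx); lra.
have hs : has_sup S by split; [exists a; split|exists b => x /Sb].
pose s := sup S.
have as_ : a <= s by apply: ub_le_sup; [case: hs|split].
have sb : s <= b by apply: ge_sup; [case: hs|move=> x /Sb].
have s0 : 0 < s by apply: lt_le_trans as_.
have lts x : 0 < x -> x < s -> f x < 0.
  move=> x0 xs; have [y [ay fy] xy] := sup_gt hs.1 xs.
  by apply: le_lt_trans fy; apply: fnd => //; exact: ltW.
have gts x : s < x -> 0 <= f x.
  move=> sx; rewrite leNgt; apply/negP => fx.
  have : x <= s by apply: ub_le_sup; [case: hs|split=> //; apply: le_trans (ltW sx)].
  by rewrite leNgt sx.
have [m sup] := concave_pos_support cf s0.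
have fs : f s = 0.
  apply/eqP; case: (ltgtP (f s) 0) => // fs; exfalso.
    have sb' : s < b by rewrite lt_neqAle sb andbT; apply/eqP => sE; move: fs; rewrite sE; lra.
    have m0 : 0 < m by have := sup _ b0; nra.
    pose d := - f s / (2 * m).
    have d0 : 0 < d by rewrite divr_gt0 //; lra.
    have := gts (s + d); have := sup (s + d).
    have -> : m * (s + d - s) = - f s / 2 by rewrite /d; field; rewrite gt_eqF.
    by move=> /(_ ltac:(lra)) h1 /(_ ltac:(lra)); lra.
  have as' : a < s by rewrite lt_neqAle as_ andbT; apply/eqP => sE; move: fs; rewrite -sE; lra.
  (* Half the distance from [s] back to the point where the chord from [a] to [s] crosses zero. *)
  pose d := (s - a) * f s / (2 * (f s - f a)).
  have D0 : 0 < 2 * (f s - f a) by lra.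
  have dE : d * (2 * (f s - f a)) = (s - a) * f s by rewrite /d divfK // gt_eqF.
  have d0 : 0 < d by rewrite divr_gt0 // mulr_gt0 //; lra.
  have d1 : d < s - a by rewrite ltr_pdivrMr //; nra.
  have := lts (s - d) ltac:(lra) ltac:(lra).
  have := @concave_pos_chord f a (s - d) s cf a0 ltac:(lra) ltac:(lra).
  by nra.
exists s; split=> // x sx.
(* Strict positivity after [s] comes from the chord joining the zero at [s] to a point where [f] is
   positive. *)
have bx : 0 < f (b + x) by apply: (lt_le_trans fb); apply: fnd => //; lra.
have := @concave_pos_chord f s x (b + x) cf s0 (ltW sx) ltac:(lra).
by rewrite fs; nra.
Qed.

End ConcavePos.

(** * Kedlaya's mixed-mean inequality *)

(* The perspective [y * h (x / y)] of a concave function is superadditive: it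
   lies below the linear function given by a supporting line of [h] at
   [x / y], with equality at the point [(x, y)]. *)
Lemma concave_pos_perspective3 (R : realType) (h : R -> R)
    (w1 w2 w3 w x1 x2 x3 x y1 y2 y3 y : R) : concave_pos h ->
  0 <= w1 -> 0 <= w2 -> 0 <= w3 ->
  0 < x1 -> 0 < x2 -> 0 < x3 -> 0 < x ->
  0 < y1 -> 0 < y2 -> 0 < y3 -> 0 < y ->
  w1 * x1 + w2 * x2 + w3 * x3 = w * x ->
  w1 * y1 + w2 * y2 + w3 * y3 = w * y ->
  w1 * (y1 * h (x1 / y1)) + w2 * (y2 * h (x2 / y2)) + w3 * (y3 * h (x3 / y3))
    <= w * (y * h (x / y)).
Proof.
move=> ch w10 w20 w30 x10 x20 x30 x0 y10 y20 y30 y0 wx wy.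
have [m hm] := concave_pos_support ch (divr_gt0 x0 y0).
have le u v : 0 < u -> 0 < v ->
    v * h (u / v) <= v * h (x / y) + m * (u - v * (x / y)).
  move=> u0 v0; have huv := hm _ (divr_gt0 u0 v0).
  rewrite -(ler_pM2l v0) in huv; apply: (le_trans huv); rewrite le_eqVlt; apply/orP; left.
  by apply/eqP; field; rewrite !gt_eqF.
have := ler_wpM2l w10 (le _ _ x10 y10).
have := ler_wpM2l w20 (le _ _ x20 y20).
have := ler_wpM2l w30 (le _ _ x30 y30).
move=> l3 l2 l1; apply: le_trans (lerD (lerD l1 l2) l3) _.
rewrite le_eqVlt; apply/orP; left; apply/eqP.
transitivity ((w1 * y1 + w2 * y2 + w3 * y3) * h (x / y) +
  m * ((w1 * x1 + w2 * x2 + w3 * x3) - (w1 * y1 + w2 * y2 + w3 * y3) * (x / y))).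
  by ring.
by rewrite wx wy; field; rewrite gt_eqF.
Qed.

Section Weights.
Variables (R : realType) (lam : nat -> R).
Hypothesis lam_W0 : W0 lam.
Let L := partial_weight lam.

Lemma lam_ge0 n : 0 <= lam n. Proof. exact: lam_W0.2. Qed.

Lemma partial_weight0 : L 0 = lam 0%N.
Proof. by rewrite /L /partial_weight big_ord_recl big_ord0 addr0. Qed.

Lemma partial_weightS n : L n.+1 = L n + lam n.+1.
Proof. by rewrite /L /partial_weight big_ord_recr. Qed.

Lemma partial_weight_gt0 n : 0 < L n.
Proof.
elim: n => [|n IH]; first by rewrite partial_weight0; exact: lam_W0.1.
by rewrite partial_weightS ltr_wpDr // lam_ge0.
Qed.

Lemma partial_weight_nd m n : (m <= n)%N -> L m <= L n.
Proof.
apply: (@homo_leq _ L <=%R) => [//|y x z|k]; first exact: le_trans.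
by rewrite partial_weightS lerDl lam_ge0.
Qed.

Hypothesis lam_mono : nonincreasing_seq (fun n => lam n / partial_weight lam n).

Definition weighted_sum (x : nat -> R) n := \sum_(i < n.+1) lam i * x i.

Lemma weighted_sumS x n :
  weighted_sum x n.+1 = weighted_sum x n + lam n.+1 * x n.+1.
Proof. by rewrite /weighted_sum big_ord_recr. Qed.

Lemma weighted_sum_gt0 x n : (forall i, 0 < x i) -> 0 < weighted_sum x n.
Proof.
move=> x0; elim: n => [|n IH].
  by rewrite /weighted_sum big_ord_recl big_ord0 addr0 mulr_gt0 // lam_W0.1.
by rewrite weighted_sumS ltr_wpDr // mulr_ge0 ?lam_ge0 // ltW.
Qed.

Lemma weighted_sum_nd x m n : (forall i, 0 < x i) -> (m <= n)%N ->
  weighted_sum x m <= weighted_sum x n.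
Proof.
move=> x0; apply: (@homo_leq _ (weighted_sum x) <=%R) => [//|v u w|k]; first exact: le_trans.
by rewrite weighted_sumS lerDl mulr_ge0 ?lam_ge0 // ltW.
Qed.

(* Kedlaya's weighted mixed-mean inequality.  In the induction step, with
   [p := lam n / L n], the pair [(A k, B n)] of weighted averages, taken with
   weight [lam k], is the combination of [(x k, y n)], [(A k, B n.-1)] and
   [(A k.-1, B n.-1)] with weights [p * lam k], [lam k - p * L k] and
   [p * L k.-1]; the second one is nonnegative because [lam k / L k] is
   nonincreasing, and the last two telescope when summed over [k]. *)
Lemma mixed_mean (h : R -> R) (x y : nat -> R) : concave_pos h ->
  (forall n, 0 < x n) -> (forall n, 0 < y n) ->
  (forall n, 0 <= \sum_(i < n.+1) lam i * h (x i / y n)) ->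
  forall n, 0 <= \sum_(k < n.+1)
    lam k * h ((weighted_sum x k / L k) / (weighted_sum y n / L n)).
Proof.
move=> ch x0 y0 hxy.
set A := fun k => weighted_sum x k / L k.
set B := fun n => weighted_sum y n / L n.
have A0 k : 0 < A k by rewrite divr_gt0 ?weighted_sum_gt0 ?partial_weight_gt0.
have B0 k : 0 < B k by rewrite divr_gt0 ?weighted_sum_gt0 ?partial_weight_gt0.
elim=> [|n IH].
  have := hxy 0%N; rewrite !big_ord_recl !big_ord0 !addr0.
  rewrite /A /B /weighted_sum !big_ord_recl !big_ord0 !addr0 partial_weight0 /=.
  have e v : lam 0%N * v / lam 0%N = v.
    by rewrite mulrAC divff ?mul1r // gt_eqF // lam_W0.1.
  by rewrite !e.
set p := lam n.+1 / L n.+1.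
have L0 k := partial_weight_gt0 k.
have p0 : 0 <= p by rewrite divr_ge0 ?lam_ge0 // ltW.
have BE : B n.+1 = (1 - p) * B n + p * y n.+1.
  rewrite /B weighted_sumS /p.
  have -> : 1 - lam n.+1 / L n.+1 = L n / L n.+1.
    by rewrite partial_weightS; field; rewrite -partial_weightS gt_eqF.
  by field; rewrite !gt_eqF.
pose a k := h (A k / B n).
pose D k := (lam k - p * L k) * a k + (if k is k'.+1 then p * L k' * a k' else 0).
have DE m : \sum_(k < m.+1) D k = \sum_(k < m.+1) lam k * a k - p * L m * a m.
  elim: m => [|m IHm]; first by rewrite !big_ord_recl !big_ord0 /D /=; ring.
  by rewrite big_ord_recr IHm [in RHS]big_ord_recr /D /=; ring.
have step k : (k < n.+2)%N ->
    p * lam k * (y n.+1 * h (x k / y n.+1)) + B n * D k <=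
    lam k * (B n.+1 * h (A k / B n.+1)).
  move=> kn.
  have w2 : 0 <= lam k - p * L k.
    rewrite subr_ge0 -ler_pdivlMr //; exact: lam_mono.
  (* For [k = 0] there is no previous average: the third point gets weight 0, with the placeholder
     value [1]. *)
  case: k kn w2 => [|k] kn w2.
    have := @concave_pos_perspective3 R h (p * lam 0%N) (lam 0%N - p * L 0) 0 (lam 0%N)
      (x 0%N) (A 0%N) 1 (A 0%N) (y n.+1) (B n) 1 (B n.+1) ch _ w2 (lexx 0).
    rewrite /D -/(a 0%N) mul0r !addr0 => H.
    apply: le_trans (H _ _ _ _ _ _ _ _ _ _ _) => //.
    - by rewrite le_eqVlt; apply/orP; left; apply/eqP; rewrite /a; ring.
    - by rewrite mulr_ge0 ?lam_ge0.
    - rewrite /A /weighted_sum big_ord_recl big_ord0 addr0 /= partial_weight0.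
      by field; rewrite gt_eqF // lam_W0.1.
    - by rewrite BE partial_weight0; ring.
  have := @concave_pos_perspective3 R h (p * lam k.+1) (lam k.+1 - p * L k.+1)
      (p * L k) (lam k.+1) (x k.+1) (A k.+1) (A k) (A k.+1) (y n.+1) (B n) (B n)
      (B n.+1) ch _ w2.
  move=> H; apply: le_trans (H _ _ _ _ _ _ _ _ _ _ _ _) => //.
  - by rewrite le_eqVlt; apply/orP; left; apply/eqP; rewrite /D /a; ring.
  - by rewrite mulr_ge0 ?lam_ge0.
  - by rewrite mulr_ge0 // ltW.
  - have LA j : L j * A j = weighted_sum x j by rewrite mulrC divfK // gt_eqF.
    transitivity (p * (lam k.+1 * x k.+1 + L k * A k - L k.+1 * A k.+1) + lam k.+1 * A k.+1).
      by ring.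
    by rewrite !LA weighted_sumS; ring.
  - by rewrite BE partial_weightS; ring.
(* Hence the remainder in [DE] for [m = n.+1] cancels the last term, and the sum of the [D k] is
   exactly the sum of the induction hypothesis. *)
have pL : p * L n.+1 = lam n.+1 by rewrite divfK // gt_eqF.
have : 0 <= \sum_(k < n.+2) lam k * (B n.+1 * h (A k / B n.+1)).
  have le : \sum_(k < n.+2) (p * lam k * (y n.+1 * h (x k / y n.+1)) + B n * D k) <=
      \sum_(k < n.+2) lam k * (B n.+1 * h (A k / B n.+1)).
    by apply: ler_sum => k _; exact: step.
  apply: le_trans le; rewrite big_split /= -[X in _ + X]mulr_sumr DE [X in B n * (X - _)]big_ord_recr /= pL addrK.
  apply: addr_ge0; last by rewrite mulr_ge0 // ltW.
  rewrite (eq_bigr (fun i : 'I_n.+2 => p * y n.+1 * (lam i * h (x i / y n.+1)))).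
    by rewrite -mulr_sumr; apply: mulr_ge0 (hxy _); exact: mulr_ge0 (ltW _).
  by move=> i _; ring.
rewrite (eq_bigr (fun i : 'I_n.+2 => B n.+1 * (lam i * h (A i / B n.+1)))).
  by rewrite -mulr_sumr pmulr_rge0.
by move=> i _; ring.
Qed.

(** The sum [T s n] of the overview. *)
Definition reciprocal_sum (h : R -> R) (s : R) n :=
  \sum_(i < n.+1) lam i * h (s * L n / L i).

(** The [y n] stand for the means. A failure at [n] puts the quotient [s] of the two weighted sums
    below [s0], where [G], and with it [T s n], is negative; this contradicts [mixed_mean]. *)
Lemma mixed_mean_hardy (h G : R -> R) (s0 : R) (x y : nat -> R) :
  concave_pos h -> (forall u v, 0 < u -> u <= v -> h u <= h v) ->
  (forall s n, 0 < s -> reciprocal_sum h s n <= L n * G s) ->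
  0 < s0 -> (forall s, 0 < s -> s < s0 -> G s < 0) ->
  (forall n, 0 < x n) -> (forall n, 0 < y n) ->
  (forall n, 0 <= \sum_(i < n.+1) lam i * h (x i / y n)) ->
  forall n, weighted_sum y n <= s0^-1 * weighted_sum x n.
Proof.
move=> ch hnd hG s00 Gs0 x0 y0 hxy n.
have X0 k := weighted_sum_gt0 k x0.
have Y0 k := weighted_sum_gt0 k y0.
have L0 k := partial_weight_gt0 k.
rewrite mulrC ler_pdivlMr // leNgt; apply/negP => xy.
pose s := weighted_sum x n / weighted_sum y n.
have s_gt0 : 0 < s by rewrite divr_gt0.
have ss : s < s0 by rewrite ltr_pdivrMr // mulrC.
have : reciprocal_sum h s n < 0.
  by apply: le_lt_trans (hG _ _ s_gt0) _; rewrite pmulr_rlt0 // Gs0.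
rewrite ltNge => /negP; apply.
apply: le_trans (mixed_mean ch x0 y0 hxy n) _.
apply: ler_sum => k _; apply: ler_wpM2l; first exact: lam_ge0.
apply: hnd; first by rewrite !divr_gt0.
have -> : weighted_sum x k / L k / (weighted_sum y n / L n) =
    weighted_sum x k * (L n / (L k * weighted_sum y n)).
  by field; rewrite !gt_eqF.
have -> : s * L n / L k = weighted_sum x n * (L n / (L k * weighted_sum y n)).
  by rewrite /s; field; rewrite !gt_eqF.
apply: ler_wpM2r; first by rewrite ltW // divr_gt0 // mulr_gt0.
by apply: weighted_sum_nd => //; rewrite -ltnS.
Qed.

Hypothesis lam_oo : partial_weight lam n @[n --> \oo] --> +oo.

(** As in the theorem of Abel and Dini: once [L n >= 2 * L m], the terms from [m + 1] to [n] add up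
    to at least [(L n - L m) / L n >= 1 / 2]. *)
Lemma sum_weight_ratio_unbounded (M : R) :
  exists n, M <= \sum_(i < n.+1) lam i / L i.
Proof.
have L0 k := partial_weight_gt0 k.
have half m : exists2 n, (m <= n)%N & \sum_(i < m.+1) lam i / L i + 1 / 2 <=
    \sum_(i < n.+1) lam i / L i.
  have [N _ hN] := (cvgryPge _).1 lam_oo (2 * L m).
  pose n := maxn N m; have mn : (m <= n)%N by exact: leq_maxr.
  have Ln : 2 * L m <= L n by apply: hN; exact: leq_maxl.
  exists n => //.
  have tail k : (m <= k)%N -> (k <= n)%N -> \sum_(i < m.+1) lam i / L i +
      (L k - L m) / L n <= \sum_(i < k.+1) lam i / L i.
    elim: k => [|k IH]; first by rewrite leqn0 => /eqP -> _; rewrite subrr mul0r addr0.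
    rewrite leq_eqVlt => /predU1P[-> _|mk kn]; first by rewrite subrr mul0r addr0.
    rewrite [leRHS]big_ord_recr /=.
    have := IH mk (ltnW kn); move=> IH'.
    have : lam k.+1 / L n <= lam k.+1 / L k.+1.
      apply: ler_wpM2l; first exact: lam_ge0.
      by rewrite lef_pV2 ?posrE // partial_weight_nd.
    have -> : (L k.+1 - L m) / L n = (L k - L m) / L n + lam k.+1 / L n.
      by rewrite partial_weightS; ring.
    by lra.
  apply: le_trans (tail n mn (leqnn n)); rewrite lerD2l ler_pdivlMr //; lra.
have key k : exists n, k%:R / 2 <= \sum_(i < n.+1) lam i / L i.
  elim: k => [|k [m IH]].
    exists 0%N; rewrite mul0r; apply: sumr_ge0 => i _.
    by rewrite divr_ge0 ?lam_ge0 // ltW.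
  have [n _ hn] := half m; exists n; apply: le_trans hn.
  by rewrite -natr1 mulrDl lerD2r.
have [n hn] := key (Num.bound (2 * M)).
exists n; apply: le_trans hn.
have := archi_boundP (normr_ge0 (2 * M)); have := ler_norm (2 * M).
have [M0|M0] := leP 0 (2 * M); last first.
  by move=> _ _; apply: (@le_trans _ _ 0); [lra|rewrite divr_ge0].
by rewrite ger0_norm // => _ hb; rewrite ler_pdivlMr // mulrC ltW.
Qed.

End Weights.

(** * The normalization of a quasideviation and its homogenization *)

Lemma cvg_sum_ord (R : numFieldType) (T : Type) (F : set_system T) {FF : Filter F}
    n (f : 'I_n -> T -> R) (l : 'I_n -> R) :
  (forall i, f i x @[x --> F] --> l i) ->
  \sum_(i < n) f i x @[x --> F] --> \sum_(i < n) l i.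
Proof.
elim: n f l => [|n IH] f l fl.
  rewrite big_ord0 (_ : (fun x => _) = fun=> 0); first exact: cvg_cst.
  by apply/funext => x; rewrite big_ord0.
rewrite big_ord_recl (_ : (fun x => _) =
    (fun x => f ord0 x + \sum_(i < n) f (lift ord0 i) x)); last first.
  by apply/funext => x; rewrite big_ord_recl.
by apply: cvgD; [exact: fl|apply: IH => i; exact: fl].
Qed.

Section Normalization.
Variables (R : realType) (I : set R) (E : R -> R -> R).
Hypotheses (I_itv : is_interval I) (I_neq0 : I !=set0).
Hypotheses (I_pos : forall x, I x -> 0 < x) (I_inf : inf I = 0).
Hypotheses (E_qdev : quasideviation I E) (E_norm : normalizable I E).
Hypothesis E_concave : concave_on_square I (normalization I E).
Hypothesis E_lim0 : forall x : R, 0 < x ->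
  normalization I E (x * t) t @[t --> 0^'+] --> 0.
Let F := normalization I E.
Let h := h_fun I E.

Lemma domain_down x y : I y -> 0 < x -> x <= y -> I x.
Proof.
move=> Iy x0 xy; have /(inf_lt I_neq0)[z Iz zx] : inf I < x by rewrite I_inf.
by apply: I_itv Iz Iy _ _; rewrite (ltW zx) xy.
Qed.

Lemma normalization_sg u v : I u -> I v -> Num.sg (F u v) = Num.sg (u - v).
Proof.
move=> Iu Iv; rewrite /F /normalization sgrM sgrV (@gtr0_sg _ (- _)).
  by rewrite mulr1; exact: (quasideviation_sg E_qdev).
by rewrite oppr_gt0; apply: (normalizable_lt0 E_norm).
Qed.

Lemma normalization_gt0 u v : I u -> I v -> v < u -> 0 < F u v.
Proof. by move=> Iu Iv vu; rewrite -sgr_gt0 normalization_sg // sgr_gt0 subr_gt0. Qed.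

Lemma normalization_diag u : I u -> F u u = 0.
Proof. by move=> Iu; apply/eqP; rewrite -sgr_eq0 normalization_sg // sgr_eq0 subrr. Qed.

Lemma normalization_concave a b c d t : I a -> I b -> I c -> I d ->
  0 <= t -> t <= 1 ->
  t * F a b + (1 - t) * F c d <= F (t * a + (1 - t) * c) (t * b + (1 - t) * d).
Proof.
move=> Ia Ib Ic Id t0 t1.
have := @E_concave (Itv01 t0 t1) (a, b) (c, d).
rewrite !inE => /(_ (conj Ia Ib) (conj Ic Id)).
move=> H.
have : - F (t * a + (1 - t) * c) (t * b + (1 - t) * d) <=
    t * - F a b + (1 - t) * - F c d by exact: H.
by rewrite !mulrN -opprD lerN2.
Qed.

(* Concavity along the segment from [(u, u)] to [(u, v)], where the partial
   derivative of the normalization at [(u, u)] is [- 1]. *)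
Lemma normalization_le u v : I u -> I v -> F u v <= u - v.
Proof.
move=> Iu Iv; have [->|uv] := eqVneq u v.
  by rewrite normalization_diag // subrr.
set d := d2_diag I E; have du := normalizable_lt0 E_norm Iu; rewrite -/d in du.
have cq : d2_quotient E u y @[y --> within I u^'] --> d u.
  exact: (normalizable_derivable E_norm Iu).
have cd : d y @[y --> within I u^'] --> d u.
  have := (subspace_continuousP I d).1 (normalizable_continuous E_norm) u Iu.
  apply: cvg_trans => P; rewrite /= /nbhs /= /within /dnbhs /within /= => HP.
  by apply: filterS HP => y Py _ /Py.
(* As [E u u = 0], this product is [F u y / (y - u)]. Its denominator varies with [y], which is why
   continuity of the diagonal derivative enters. *)
have cF : d2_quotient E u y * (- d y)^-1 @[y --> within I u^'] --> (-1 : R).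
  have -> : (-1 : R) = d u * (- d u)^-1 by rewrite invrN mulrN divff // lt_eqF.
  by apply: cvgM => //; apply: cvgV; [rewrite oppr_eq0 lt_eqF|exact: cvgN].
apply/ler_addgt0Pr => e e0.
have n0 : 0 < `|v - u| by rewrite normr_gt0 subr_eq0 eq_sym.
have e'0 : 0 < e / `|v - u| by rewrite divr_gt0.
have /nbhs_ballP[r /= r0 hr] : nbhs u (fun y => y != u -> I y ->
    `|-1 - d2_quotient E u y * (- d y)^-1| < e / `|v - u|).
  exact: (cvgrPdist_lt _ _).1 cF _ e'0.
(* Small enough for the point [w] of the segment to lie within [r] of [u], where the quotient is
   close to [- 1]. *)
pose t := Num.min 1 (r / (2 * `|v - u|)).
have t0 : 0 < t by rewrite lt_min ltr01 divr_gt0 // mulr_gt0.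
have t1 : t <= 1 by rewrite ge_min lexx.
have tr : t * `|v - u| < r.
  apply: (@le_lt_trans _ _ (r / (2 * `|v - u|) * `|v - u|)).
    by rewrite ler_pM2r // ge_min lexx orbT.
  by rewrite invfM mulrA mulfVK ?gt_eqF // ltr_pdivrMr //; lra.
pose w := t * v + (1 - t) * u.
have wu : w - u = t * (v - u) by rewrite /w; ring.
have Iw : I w.
  case: (ltgtP u v) uv => // uv' _.
    apply: (I_itv Iu Iv); rewrite /w; apply/andP; split; nra.
  by apply: (I_itv Iv Iu); rewrite /w; apply/andP; split; nra.
have wu0 : w - u != 0 by rewrite wu mulf_neq0 ?(gt_eqF t0) // subr_eq0 eq_sym.
have := hr w; rewrite /ball /= distrC wu normrM (gtr0_norm t0) => /(_ tr).
rewrite -subr_eq0 => /(_ wu0 Iw).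
have Euu : E u u = 0.
  by apply/eqP; rewrite -sgr_eq0 (quasideviation_sg E_qdev) // sgr_eq0 subrr.
have -> : d2_quotient E u w * (- d w)^-1 = F u w / (w - u).
  by rewrite /d2_quotient Euu subr0 /F /normalization mulrAC.
have tF : t * F u v <= F u w.
  have := normalization_concave Iu Iv Iu Iu (ltW t0) t1.
  by rewrite normalization_diag // mulr0 addr0 -mulrDl addrC subrK mul1r.
rewrite ltr_norml => /andP[lo hi].
have Fw : F u w = F u w / (w - u) * (w - u) by rewrite mulfVK.
move: lo hi tF; rewrite {3}Fw; move: (F u w / (w - u)) => q lo hi tF.
have vuE : e / `|v - u| * `|v - u| = e by rewrite mulfVK ?gt_eqF.
have : F u v <= q * (v - u) by rewrite -(ler_pM2l t0) (le_trans tF) // wu; lra.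
move=> /le_trans; apply.
have : (q + 1) * (v - u) <= e.
  apply: (le_trans (ler_norm _)); rewrite normrM -vuE; apply: ler_wpM2r => //.
  by rewrite ltW // ltr_norml; apply/andP; split; lra.
by lra.
Qed.

Lemma normalization_ray_concave x r s t : 0 < x -> I t -> I (x * t) ->
  0 < r -> r <= s -> s <= t ->
  (t - s) * F (x * r) r + (s - r) * F (x * t) t <= (t - r) * F (x * s) s.
Proof.
move=> x0 It Ixt r0 rs st.
have [rt|tr] := ltP r t; last first.
  have -> : s = r by lra.
  have -> : t = r by lra.
  by rewrite !subrr !mul0r addr0.
have tr0 : 0 < t - r by rewrite subr_gt0.
have Ir : I r by apply: domain_down It _ _ => //; exact: ltW.
have Ixr : I (x * r) by apply: domain_down Ixt _ _; [exact: mulr_gt0|rewrite ler_pM2l // ltW].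
have l0 : 0 <= (t - s) / (t - r) by rewrite divr_ge0 ?subr_ge0 // ltW.
have l1 : (t - s) / (t - r) <= 1 by rewrite ler_pdivrMr // mul1r; lra.
have := normalization_concave Ixr Ir Ixt It l0 l1.
have -> : (t - s) / (t - r) * (x * r) + (1 - (t - s) / (t - r)) * (x * t) = x * s.
  by field; rewrite gt_eqF.
have -> : (t - s) / (t - r) * r + (1 - (t - s) / (t - r)) * t = s.
  by field; rewrite gt_eqF.
rewrite -(ler_pM2l tr0); apply: le_trans; rewrite le_eqVlt; apply/orP; left.
by apply/eqP; field; rewrite gt_eqF.
Qed.

(** Along the ray, [r => F (x * r) r] is concave and tends to 0 at 0, so its slopes from the origin
    are nonincreasing: let [r] tend to 0 in [normalization_ray_concave]. *)
Lemma normalization_ray_nonincreasing x s t : 0 < x -> I t -> I (x * t) ->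
  0 < s -> s <= t -> t^-1 * F (x * t) t <= s^-1 * F (x * s) s.
Proof.
move=> x0 It Ixt s0 st; have t0 : 0 < t by exact: I_pos.
rewrite ler_pdivrMl // mulrCA ler_pdivlMl //.
have id0 : (r : R) @[r --> 0^'+] --> (0 : R) by apply: cvg_at_right_filter; exact: cvg_id.
have -> : s * F (x * t) t = (t - s) * 0 + (s - 0) * F (x * t) t by ring.
have -> : t * F (x * s) s = (t - 0) * F (x * s) s by ring.
apply: (@ler_cvg_to _ (0^'+) _ _ (fun r => (t - s) * F (x * r) r + (s - r) * F (x * t) t)
  (fun r => (t - r) * F (x * s) s)).
- apply: cvgD; first by apply: cvgMr; exact: E_lim0.
  by apply: cvgMl; apply: cvgB => //; exact: cvg_cst.
- by apply: cvgMl; apply: cvgB => //; exact: cvg_cst.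
near=> r.
have r0 : 0 < r by near: r; exact: nbhs_right_gt.
have rs : r <= s by near: r; exact: nbhs_right_le.
exact: normalization_ray_concave.
Unshelve. all: by end_near. Qed.

(** The quotient is monotone and bounded by [x - 1], by [normalization_le]; so it converges at
    [0^'+] to its supremum. *)
Lemma h_fun_spec x t : 0 < x -> I t -> I (x * t) ->
  (s^-1 * F (x * s) s @[s --> 0^'+] --> h x) /\ t^-1 * F (x * t) t <= h x.
Proof.
move=> x0 It Ixt; have t0 := I_pos It.
pose g s := s^-1 * F (x * s) s.
have Is s : 0 < s -> s <= t -> I s /\ I (x * s).
  move=> s0 st; split; [exact: domain_down It _ _|].
  by apply: domain_down Ixt _ _; rewrite ?mulr_gt0 // ler_pM2l.
have gle s : 0 < s -> s <= t -> g s <= x - 1.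
  move=> s0 st; have [I1 I2] := Is _ s0 st.
  by rewrite ler_pdivrMl // (le_trans (normalization_le I2 I1)) //; lra.
have hub : has_ubound (g @` `]0, t]).
  by exists (x - 1) => _ [s + <-]; rewrite /= in_itv /= => /andP[]; exact: gle.
have cg : g s @[s --> 0^'+] --> sup (g @` `]0, t]).
  apply: (@nonincreasing_at_right_cvgr _ g 0 (BRight t)) => //.
  move=> u v; rewrite !in_itv /= => /andP[u0 ut] /andP[v0 vt] uv.
  by have [I1 I2] := Is _ v0 vt; apply: normalization_ray_nonincreasing.
have -> : h x = sup (g @` `]0, t]) by apply/cvg_lim.
split=> //; apply: ub_le_sup => //; exists t => //=.
by rewrite in_itv /= t0 lexx.
Qed.

Lemma ray_in_domain x y : 0 < x -> 0 < y ->
  exists2 t, I t & I (x * t) /\ I (y * t).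
Proof.
move=> x0 y0; have [b Ib] := I_neq0; have b0 := I_pos Ib.
have D0 : 0 < 1 + x + y by rewrite !addr_gt0.
have le z : 0 < z -> z <= 1 + x + y -> I (z * (b / (1 + x + y))).
  move=> z0 zD; apply: domain_down Ib _ _; first by rewrite !mulr_gt0 ?invr_gt0.
  by rewrite mulrCA ger_pMr // ler_pdivrMr // mul1r.
exists (b / (1 + x + y)); last by split; apply: le => //; lra.
by rewrite -[b / _]mul1r; apply: le => //; lra.
Qed.

Lemma h_fun_cvg x : 0 < x -> s^-1 * F (x * s) s @[s --> 0^'+] --> h x.
Proof.
move=> x0; have [t It [Ixt _]] := ray_in_domain x0 x0.
by have [] := h_fun_spec x0 It Ixt.
Qed.

Lemma normalization_le_h u v : I u -> I v -> F u v <= v * h (u / v).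
Proof.
move=> Iu Iv; have u0 := I_pos Iu; have v0 := I_pos Iv.
have uv : u / v * v = u by rewrite mulfVK // gt_eqF.
have [_] := @h_fun_spec (u / v) v (divr_gt0 u0 v0) Iv ltac:(by rewrite uv).
by rewrite uv ler_pdivrMl.
Qed.

Lemma h_fun_le x : 0 < x -> h x <= x - 1.
Proof.
move=> x0; have [t It [Ixt _]] := ray_in_domain x0 x0; have t0 := I_pos It.
apply: (ler_cvg_to (h_fun_cvg x0) (@cvg_cst _ (x - 1) _ (0^'+) _)).
near=> s.
have s0 : 0 < s by near: s; exact: nbhs_right_gt.
have st : s <= t by near: s; exact: nbhs_right_le.
have Is : I s by exact: domain_down It _ _.
have Ixs : I (x * s) by apply: domain_down Ixt _ _; rewrite ?mulr_gt0 // ler_pM2l.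
by rewrite ler_pdivrMl // (le_trans (normalization_le _ _)) //; lra.
Unshelve. all: by end_near. Qed.

Lemma h_fun1 : h 1 = 0.
Proof.
have [t It _] := ray_in_domain ltr01 ltr01; have t0 := I_pos It.
apply/cvg_lim => //; apply: cvg_near_cst; near=> s.
have s0 : 0 < s by near: s; exact: nbhs_right_gt.
have st : s <= t by near: s; exact: nbhs_right_le.
have Is : I s by exact: domain_down It _ _.
by rewrite mul1r -/F normalization_diag ?mulr0.
Unshelve. all: by end_near. Qed.

Lemma h_fun_gt0 x : 1 < x -> 0 < h x.
Proof.
move=> x1; have x0 : 0 < x by lra.
have [t It [Ixt _]] := ray_in_domain x0 x0; have t0 := I_pos It.
have [_] := h_fun_spec x0 It Ixt; apply: lt_le_trans.
by rewrite mulr_gt0 ?invr_gt0 // normalization_gt0 // ltr_pMl.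
Qed.

Lemma h_fun_concave : concave_pos h.
Proof.
move=> x y l x0 y0 l0 l1; have [t It [Ixt Iyt]] := ray_in_domain x0 y0.
have t0 := I_pos It.
have z0 : 0 < l * x + (1 - l) * y.
  have [->|l0'] := eqVneq l 0; first by rewrite mul0r add0r subr0 mul1r.
  by rewrite ltr_wpDr ?mulr_gt0 // ?lt_neqAle ?l0 1?eq_sym ?l0' // mulr_ge0 ?subr_ge0 // ltW.
have c : l * (s^-1 * F (x * s) s) + (1 - l) * (s^-1 * F (y * s) s) @[s --> 0^'+]
    --> l * h x + (1 - l) * h y.
  by apply: cvgD; apply: cvgMr; exact: h_fun_cvg.
apply: (ler_cvg_to c (h_fun_cvg z0)).
near=> s.
have s0 : 0 < s by near: s; exact: nbhs_right_gt.
have st : s <= t by near: s; exact: nbhs_right_le.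
have Is : I s by exact: domain_down It _ _.
have Ixs : I (x * s) by apply: domain_down Ixt _ _; rewrite ?mulr_gt0 // ler_pM2l.
have Iys : I (y * s) by apply: domain_down Iyt _ _; rewrite ?mulr_gt0 // ler_pM2l.
have := normalization_concave Ixs Is Iys Is l0 l1.
have -> : l * s + (1 - l) * s = s by ring.
have -> : l * (x * s) + (1 - l) * (y * s) = (l * x + (1 - l) * y) * s by ring.
have si0 : 0 < s^-1 by rewrite invr_gt0.
rewrite -(ler_pM2l si0).
by apply: le_trans; rewrite le_eqVlt; apply/orP; left; apply/eqP; ring.
Unshelve. all: by end_near. Qed.

Lemma h_fun_nd u v : 0 < u -> u <= v -> h u <= h v.
Proof. by apply: concave_pos_nondecreasing; [exact: h_fun_concave|exact: h_fun_gt0]. Qed.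

(** A solution exists by the intermediate value theorem between the least and the greatest entry, so
    [get] returns one. The factor relating [E] to [F] depends on the second argument alone and comes
    out of the sum. *)
Lemma quasidev_mean_spec n (x w : 'I_n.+1 -> R) :
  (forall i, I (x i)) -> (forall i, 0 <= w i) ->
  I (quasidev_mean I E x w) /\
  \sum_(i < n.+1) w i * F (x i) (quasidev_mean I E x w) = 0.
Proof.
move=> Ix w0.
have ex : exists y, I y /\ \sum_(i < n.+1) w i * E (x i) y = 0.
  have [i0 _ hi0] := arg_minP x (erefl : predT (@ord0 n)).
  have [i1 _ hi1] := arg_maxP x (erefl : predT (@ord0 n)).
  have mM : x i0 <= x i1 by exact: hi0.
  pose g y := \sum_(i < n.+1) w i * E (x i) y.
  have sub : `[x i0, x i1] `<=` I.
    by move=> z; rewrite /= in_itv /=; exact: I_itv.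
  have cg : {within `[x i0, x i1], continuous g}.
    apply: (continuous_subspaceW sub); apply/subspace_continuousP => z Iz.
    apply: cvg_sum_ord => i; apply: cvgMr.
    exact: (subspace_continuousP I (E (x i))).1 (quasideviation_continuous E_qdev (Ix i)) z Iz.
  have g0 : 0 <= g (x i0).
    apply: sumr_ge0 => i _; rewrite mulr_ge0 // -sgr_ge0 (quasideviation_sg E_qdev) //.
    by rewrite sgr_ge0 subr_ge0 hi0.
  have g1 : g (x i1) <= 0.
    apply: sumr_le0 => i _; rewrite mulr_ge0_le0 // -sgr_le0 (quasideviation_sg E_qdev) //.
    by rewrite sgr_le0 subr_le0; apply: hi1.
  have [|y yI gy] := IVT mM cg (v := 0); last first.
    by exists y; split => //; apply: sub.
  by rewrite ge_min le_max g0 g1 orbT.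
have [Iy yE] := getPex ex; split => //.
rewrite /F /normalization; under eq_bigr do rewrite mulrA.
by rewrite -mulr_suml yE mul0r.
Qed.

(** The weighted sum is concave in the second argument. It is positive at [z] and at any point [m]
    below all entries, hence everywhere between; a mean below [z] would be a zero there. *)
Lemma le_quasidev_mean n (x w : 'I_n.+1 -> R) z :
  (forall i, I (x i)) -> (forall i, 0 <= w i) -> I z -> 0 < w ord0 ->
  0 < \sum_(i < n.+1) w i * F (x i) z ->
  z <= quasidev_mean I E x w.
Proof.
move=> Ix w0 Iz w00 gz0.
have [Iy gy] := quasidev_mean_spec Ix w0.
set y := quasidev_mean I E x w in Iy gy *.
rewrite leNgt; apply/negP => yz.
have [i0 _ hi0] := arg_minP x (erefl : predT (@ord0 n)).
have y0 := I_pos Iy; have x0 := I_pos (Ix i0).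
pose m := Num.min y (x i0) / 2.
have mn0 : 0 < Num.min y (x i0) by rewrite lt_min y0 x0.
have m0 : 0 < m by rewrite divr_gt0.
have mmin : m < Num.min y (x i0) by rewrite /m; lra.
have [my mx] : m < y /\ m < x i0 by move: mmin; rewrite lt_min => /andP.
have Im : I m by apply: domain_down Iy _ _ => //; exact: ltW.
pose g t := \sum_(i < n.+1) w i * F (x i) t.
have gm : 0 < g m.
  rewrite /g big_ord_recl ltr_wpDr //.
    apply: sumr_ge0 => i _; rewrite mulr_ge0 // ltW // normalization_gt0 //.
    by rewrite (lt_le_trans mx) // hi0.
  by rewrite mulr_gt0 // normalization_gt0 // (lt_le_trans mx) // hi0.
have zm0 : 0 < z - m by rewrite subr_gt0 (lt_trans my).
pose t := (z - y) / (z - m).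
have tgt : 0 < t by rewrite divr_gt0 // subr_gt0.
have t0 := ltW tgt.
have t1 : t <= 1 by rewrite ler_pdivrMr // mul1r; lra.
have tE : t * m + (1 - t) * z = y by rewrite /t; field; rewrite gt_eqF.
have : t * g m + (1 - t) * g z <= g y.
  rewrite /g !mulr_sumr -big_split /=; apply: ler_sum => i _.
  have := normalization_concave (Ix i) Im (Ix i) Iz t0 t1.
  have -> : t * x i + (1 - t) * x i = x i by ring.
  rewrite tE => H.
  rewrite !(mulrCA _ (w i)) -mulrDr; apply: ler_wpM2l => //.
have := mulr_gt0 tgt gm; have u0 : 0 <= 1 - t by rewrite subr_ge0.
by have := mulr_ge0 u0 (ltW gz0); rewrite [g y]gy -/(g z); lra.
Qed.

End Normalization.

(** * Bounds on the Hardy constant *)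

Lemma nneseries_le_bound (R : realType) (u : nat -> R) (M : R) :
  (forall n, 0 <= u n) -> (forall n, \sum_(i < n) u i <= M) ->
  (\sum_(0 <= n <oo) (u n)%:E <= M%:E)%E.
Proof.
move=> u0 uM; apply: lime_le.
  by apply: is_cvg_nneseries => n _ _; rewrite lee_fin.
by apply: nearW => n; rewrite sumEFin lee_fin big_mkord.
Qed.

Lemma nneseries_ge_partial (R : realType) (u : nat -> R) n :
  (forall n, 0 <= u n) -> ((\sum_(i < n) u i)%:E <= \sum_(0 <= n <oo) (u n)%:E)%E.
Proof.
move=> u0; have := @nneseries_lim_ge R (fun n => (u n)%:E) xpredT 0%N n.
rewrite sumEFin big_mkord; apply => k _ _; by rewrite lee_fin.
Qed.

Section HardyInequality.
Variables (R : realType) (I : set R) (E : R -> R -> R) (lam : nat -> R).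
Hypotheses (I_itv : is_interval I) (I_neq0 : I !=set0).
Hypotheses (I_pos : forall x, I x -> 0 < x) (I_inf : inf I = 0).
Hypotheses (lam_W0 : W0 lam)
  (lam_mono : nonincreasing_seq (fun n => lam n / partial_weight lam n))
  (lam_oo : partial_weight lam n @[n --> \oo] --> +oo).
Hypotheses (E_qdev : quasideviation I E) (E_norm : normalizable I E).
Hypothesis E_concave : concave_on_square I (normalization I E).
Hypothesis E_lim0 : forall x : R, 0 < x ->
  normalization I E (x * t) t @[t --> 0^'+] --> 0.
Let F := normalization I E.
Let h := h_fun I E.
Let L := partial_weight lam.

Let mean (x : nat -> R) n :=
  quasidev_mean I E (fun i : 'I_n.+1 => x i) (fun i => lam i).

Let mean_domain x n : (forall i, I (x i)) -> I (mean x n).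
Proof.
move=> Ix; have [|//] := quasidev_mean_spec I_itv E_qdev (w := fun i : 'I_n.+1 => lam i) (fun i => Ix i).
by move=> i; exact: lam_ge0.
Qed.

Lemma quasidev_mean_hardy (G : R -> R) (s0 : R) :
  (forall s n, 0 < s -> reciprocal_sum lam h s n <= L n * G s) ->
  0 < s0 -> (forall s, 0 < s -> s < s0 -> G s < 0) ->
  hardy_inequality I lam (quasidev_mean I E) (s0^-1)%:E.
Proof.
move=> hG s00 Gs x Ix.
have lam0 := lam_ge0 lam_W0.
have Iy n := mean_domain n Ix.
have x0 n := I_pos (Ix n); have y0 n := I_pos (Iy n).
(* The equation defining the mean, weakened by [F u v <= v * h (u / v)]. *)
have hxy n : 0 <= \sum_(i < n.+1) lam i * h (x i / mean x n).
  have [_ s0E] := quasidev_mean_spec I_itv E_qdev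
    (x := fun i : 'I_n.+1 => x i) (w := fun i : 'I_n.+1 => lam i) (fun i => Ix i) (fun i => lam0 i).
  rewrite -(pmulr_rge0 _ (y0 n)) mulr_sumr -[leLHS]s0E.
  apply: ler_sum => i _; rewrite [leRHS]mulrCA; apply: ler_wpM2l => //.
  exact: (normalization_le_h I_itv I_neq0 I_pos I_inf E_qdev E_norm E_concave E_lim0 (Ix i) (Iy n)).
have bound := mixed_mean_hardy lam_W0 lam_mono
  (h_fun_concave I_itv I_neq0 I_pos I_inf E_qdev E_norm E_concave E_lim0)
  (h_fun_nd I_itv I_neq0 I_pos I_inf E_qdev E_norm E_concave E_lim0) hG s00 Gs x0 y0 hxy.
have lx0 i : 0 <= lam i * x i by rewrite mulr_ge0 // ltW.
have step n : ((\sum_(i < n.+1) lam i * mean x i)%:E <=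
    (s0^-1)%:E * \sum_(0 <= n <oo) (lam n * x n)%:E)%E.
  apply: le_trans (_ : ((s0^-1)%:E * (\sum_(i < n.+1) lam i * x i)%:E <= _)%E).
    by rewrite -EFinM lee_fin; exact: bound.
  apply: lee_wpmul2l; first by rewrite lee_fin invr_ge0 ltW.
  exact: nneseries_ge_partial.
apply: lime_le.
  apply: is_cvg_nneseries => n _ _; rewrite lee_fin.
  exact: mulr_ge0 (lam0 n) (ltW (y0 n)).
apply: nearW => -[|n]; last by rewrite sumEFin big_mkord; exact: step.
rewrite big_nil; apply: mule_ge0; first by rewrite lee_fin invr_ge0 ltW.
by apply: nneseries_ge0 => n _ _; rewrite lee_fin.
Qed.

Let L0 n : 0 < L n := partial_weight_gt0 lam_W0 n.

(* [reciprocal_sum lam h b^-1 n] is the homogenized form of the sum defining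
   the mean of [1 / L 0, ..., 1 / L n], evaluated at [b / L n]. *)
Lemma reciprocal_sum_gt0 b n : 0 < b -> 0 < reciprocal_sum lam h b^-1 n ->
  exists2 d, 0 < d & forall e, 0 < e -> e < d ->
    0 < \sum_(i < n.+1) lam i * F (e / L i) (e * (b / L n)).
Proof.
move=> b0 T0; pose a i := b^-1 * L n / L i.
have a0 i : 0 < a i by rewrite divr_gt0 // mulr_gt0 // invr_gt0.
have c : \sum_(i < n.+1) lam i * (t^-1 * F (a i * t) t) @[t --> 0^'+] -->
    reciprocal_sum lam h b^-1 n.
  apply: cvg_sum_ord => i; apply: cvgMr.
  exact: (h_fun_cvg I_itv I_neq0 I_pos I_inf E_qdev E_norm E_concave E_lim0 (a0 i)).
have := cvgr_gt _ c 0 T0.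
(* The bound on [e] that makes the evaluation point [t = e * (b / L n)] smaller than [d]. *)
move=> [d /= d0 hd]; exists (d * L n / b); first by rewrite divr_gt0 // mulr_gt0.
move=> e e0 ed; pose t := e * (b / L n).
have t0 : 0 < t by rewrite mulr_gt0 // divr_gt0.
have td : t < d.
  by rewrite /t mulrA ltr_pdivrMr // -ltr_pdivlMr.
have := hd t; rewrite /ball /= sub0r normrN gtr0_norm // => /(_ td t0).
have -> : \sum_(i < n.+1) lam i * (t^-1 * F (a i * t) t) =
    t^-1 * \sum_(i < n.+1) lam i * F (e / L i) (e * (b / L n)).
  rewrite mulr_sumr; apply: eq_bigr => i _; rewrite mulrCA.
  congr (_ * (_ * F _ _)); rewrite /a /t; field.
  by rewrite !gt_eqF.
by rewrite pmulr_rgt0 ?invr_gt0.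
Qed.

Let ratio_sum k := \sum_(i < k) lam i / L i.

Let ratio_sum_nd k m : (k <= m)%N -> ratio_sum k <= ratio_sum m.
Proof.
apply: (@homo_leq _ ratio_sum <=%R) => [//|v u w|j]; first exact: le_trans.
by rewrite /ratio_sum big_ord_recr lerDl divr_ge0 ?(lam_ge0 lam_W0) // ltW.
Qed.

(** Take [x n = e / L n] up to a large [N]. The means are at least [e * b / L n] for [n0 <= n <= N],
    so both sides are governed by the divergent sum of [lam n / L n], with factors [b] and [C]. *)
Lemma hardy_constant_ge b C : 0 < b -> 0 <= C ->
  hardy_inequality I lam (quasidev_mean I E) C%:E ->
  (\forall n \near \oo, 0 < reciprocal_sum lam h b^-1 n) -> b <= C.
Proof.
move=> b0 C0 hC [n0 _ hn0].
have lam0 := lam_ge0 lam_W0.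
rewrite leNgt; apply/negP => Cb; have bC : 0 < b - C by rewrite subr_gt0.
(* Chosen to contradict the final estimate [b * (ratio_sum N.+1 - ratio_sum n0) <= C * (ratio_sum
   N.+1 + 2)]. *)
have [N hN] := sum_weight_ratio_unbounded lam_W0 lam_oo
  ((b * ratio_sum n0 + 2 * C + 1) / (b - C)).
(* One threshold for the finitely many indices from [n0] to [N]. *)
have [d d0 hd] : exists2 d, 0 < d & forall e n, 0 < e -> e < d -> (n0 <= n)%N ->
    (n <= N)%N -> 0 < \sum_(i < n.+1) lam i * F (e / L i) (e * (b / L n)).
  elim: N {hN} => [|N [d d0 hd]].
    have [n00|n00] := leqP n0 0.
      have [d d0 hd] := reciprocal_sum_gt0 b0 (hn0 0%N n00).
      by exists d => // e n e0 ed _; rewrite leqn0 => /eqP ->; exact: hd.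
    exists 1 => // e n _ _ nn; rewrite leqn0 => /eqP n00'.
    by move: nn; rewrite n00' leqNgt n00.
  have [nN|Nn] := leqP n0 N.+1.
    have [d' d'0 hd'] := reciprocal_sum_gt0 b0 (hn0 N.+1 nN).
    exists (Num.min d d'); first by rewrite lt_min d0.
    move=> e n e0; rewrite lt_min => /andP[ed ed'] n0n.
    by rewrite leq_eqVlt => /predU1P[->|]; [exact: hd'|rewrite ltnS; exact: hd].
  exists d => // e n e0 ed n0n nN.
  by move: (leq_trans Nn n0n); rewrite ltnNge nN.
have [B IB] := I_neq0; have B0 := I_pos IB.
have D0 : 0 < 1 + (L 0)^-1 + b / L 0.
  by rewrite !addr_gt0 // ?invr_gt0 // divr_gt0.
(* The second bound keeps the test values and the points [e * (b / L n)] inside [I]. *)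
pose e := Num.min (d / 2) (B / (1 + (L 0)^-1 + b / L 0)).
have e0 : 0 < e by rewrite lt_min !divr_gt0.
have ed : e < d by rewrite gt_min; apply/orP; left; lra.
have Ie y : 0 < y -> y <= 1 + (L 0)^-1 + b / L 0 -> I (e * y).
  move=> y0 yD; apply: (domain_down I_itv I_neq0 I_inf IB); first exact: mulr_gt0.
  apply: (@le_trans _ _ (e * (1 + (L 0)^-1 + b / L 0))); first by rewrite ler_pM2l.
  by rewrite -ler_pdivlMr // ge_min lexx orbT.
have Li n : (L n)^-1 <= (L 0)^-1.
  by rewrite lef_pV2 ?posrE //; exact: (partial_weight_nd lam_W0).
have iL0 n : 0 < (L n)^-1 by rewrite invr_gt0.
have lam1 n : 0 < 1 + lam n by rewrite ltr_wpDr.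
(* Values in [I] are positive, so the sequence cannot stop at [N]; beyond it,
   [lam n * x n <= e * 2^-1 ^+ n], and this tail costs at most [2 * e]. *)
pose a n := if (n <= N)%N then (L n)^-1 else 2^-1 ^+ n / (1 + lam n).
pose x n := e * a n.
have bL0 : 0 < b / L 0 by rewrite divr_gt0.
have half_le1 n : (2^-1 : R) ^+ n <= 1 by rewrite exprn_ile1 // ?invr_ge0 //; lra.
have half_gt0 n : 0 < (2^-1 : R) ^+ n by rewrite exprn_gt0 // invr_gt0.
have Ix n : I (x n).
  rewrite /x /a; case: ifP => _; apply: Ie.
  - by [].
  - by apply: (le_trans (Li n)); lra.
  - by rewrite divr_gt0.
  - apply: (@le_trans _ _ 1); last by have := iL0 0%N; lra.
    by rewrite ler_pdivrMr // mul1r; have := lam0 n; have := half_le1 n; lra.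
have x0 n := I_pos (Ix n).
have Iy n := mean_domain n Ix; have y0 n := I_pos (Iy n).
have lo m : (m <= N.+1)%N ->
    e * b * (ratio_sum m - ratio_sum n0) <= \sum_(n < m) lam n * mean x n.
  elim: m => [_|m IH mN].
    rewrite big_ord0 /ratio_sum big_ord0 sub0r mulrN oppr_le0 mulr_ge0 //.
      by rewrite mulr_ge0 // ltW.
    by apply: sumr_ge0 => i _; rewrite divr_ge0 // ltW.
  have [n0m|mn0] := leqP n0 m; last first.
    apply: (@le_trans _ _ 0); last by apply: sumr_ge0 => i _; rewrite mulr_ge0 // ltW.
    by rewrite mulr_ge0_le0 // ?subr_le0 ?ratio_sum_nd // mulr_ge0 // ltW.
  rewrite big_ord_recr /= /ratio_sum big_ord_recr /= -/(ratio_sum m).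
  have : e * (b / L m) <= mean x m.
    apply: (le_quasidev_mean I_itv I_neq0 I_pos I_inf E_qdev E_norm E_concave) => //.
    - apply: Ie; first by rewrite divr_gt0.
      have : b / L m <= b / L 0 by rewrite ler_pM2l.
      by have := iL0 0%N; lra.
    - exact: lam_W0.1.
    - have := hd e m e0 ed n0m mN; rewrite (eq_bigr (fun i : 'I_m.+1 => lam i * F (x i) (e * (b / L m)))) //.
      move=> i _; rewrite /x /a ifT //.
      by rewrite -ltnS (leq_trans (ltn_ord i) mN).
  move=> /(ler_wpM2l (lam0 m)) hm.
  have := IH (ltnW mN) => {}IH.
  have -> : e * b * (ratio_sum m + lam m / L m - ratio_sum n0) =
      e * b * (ratio_sum m - ratio_sum n0) + lam m * (e * (b / L m)) by ring.
  exact: lerD.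
(* Here [2 - 2 * 2^-1 ^+ m] is the sum of the first [m] powers of [2^-1], which makes the bound
   inductive. *)
have hi m : \sum_(n < m) lam n * x n <=
    e * (ratio_sum (minn m N.+1) + 2 - 2 * 2^-1 ^+ m).
  elim: m => [|m IH].
    by rewrite big_ord0 min0n /ratio_sum big_ord0 expr0; nra.
  rewrite big_ord_recr /= exprS mulrA mulfV // mul1r.
  have hm := half_gt0 m; have := lerD IH (lexx (lam m * x m)).
  move=> /le_trans; apply; rewrite /x /a.
  have [mN|Nm] := leqP m N.
    rewrite (minn_idPl _) ?(leqW mN) // (minn_idPl _) ?ltnS //.
    rewrite {2}/ratio_sum big_ord_recr /= -/(ratio_sum m).
    have -> : lam m * (e * (L m)^-1) = e * (lam m / L m) by ring.
    by nra.
  rewrite !(minn_idPr _) // ?(leqW Nm) //.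
  have : lam m * (e * (2^-1 ^+ m / (1 + lam m))) <= e * 2^-1 ^+ m.
    rewrite mulrCA ler_pM2l // mulrA ler_pdivrMr //.
    by have := lam0 m; nra.
  by lra.
have := hC x Ix; rewrite -/(mean x).
have low := @nneseries_ge_partial R (fun n => lam n * mean x n) N.+1
  (fun n => mulr_ge0 (lam0 n) (ltW (y0 n))).
have up : (\sum_(0 <= n <oo) (lam n * x n)%:E <= (e * (ratio_sum N.+1 + 2))%:E)%E.
  apply: nneseries_le_bound => [n|m]; first by rewrite mulr_ge0 // ltW.
  apply: (le_trans (hi m)); rewrite ler_pM2l //.
  have := ratio_sum_nd (geq_minr m N.+1); have := half_gt0 m.
  by lra.
move=> /(le_trans low) /le_trans /(_ (lee_wpmul2l _ up)).
rewrite lee_fin => /(_ C0); rewrite lee_fin => /(le_trans (lo _ (leqnn _))).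
have -> : e * b * (ratio_sum N.+1 - ratio_sum n0) =
  e * (b * (ratio_sum N.+1 - ratio_sum n0)) by ring.
rewrite [leRHS]mulrCA ler_pM2l //.
move: hN; rewrite ler_pdivrMr // -/(ratio_sum N.+1).
by lra.
Qed.

End HardyInequality.

(** * Integrals of nonincreasing functions on (0, 1] *)

Lemma integrable_setU d (T : measurableType d) (R : realType)
    (mu : {measure set T -> \bar R}) (A B : set T) (f : T -> \bar R) :
  measurable A -> measurable B -> [disjoint A & B] ->
  mu.-integrable A f -> mu.-integrable B f -> mu.-integrable (A `|` B) f.
Proof.
move=> mA mB AB /integrableP[mfA iA] /integrableP[mfB iB].
have mf : measurable_fun (A `|` B) f by apply/measurable_funU.
apply/integrableP; split => //; rewrite ge0_integral_setU //.
  exact: lte_add_pinfty.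
by apply: measurableT_comp => //; exact: mf.
Qed.

Section MonotoneIntegral.
Variables (R : realType) (f : R -> R).
Hypothesis f_ni : forall x y, 0 < x -> x <= y -> y <= 1 -> f y <= f x.
Let mu := @lebesgue_measure R.

Let J a b := \int[mu]_(x in `]a, b]) f x.

Let mJ (a b : R) : measurable `]a, b]%classic. Proof. exact: measurable_itv. Qed.

Lemma ni_measurable (a b : R) : 0 <= a -> b <= 1 -> measurable_fun `]a, b] f.
Proof.
move=> a0 b1; apply: (measurability (@RGenCInfty.G R)) => [|/= _ [_] [r] -> <-].
  exact: RGenCInfty.measurableE.
apply: is_interval_measurable => s t /=; rewrite !in_itv /= !andbT.
move=> [/andP[sa sb] fs] [/andP[ta tb] ft] u /andP[su ut]; split.
  by rewrite /= in_itv /= (lt_le_trans sa su) (le_trans ut tb).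
rewrite /= in_itv /= andbT (le_trans ft) //; apply: f_ni => //.
- exact: le_lt_trans a0 (lt_le_trans sa su).
- exact: le_trans tb b1.
Qed.

Let mu_itv (a b : R) : a <= b -> mu `]a, b]%classic = (b - a)%:E.
Proof.
rewrite le_eqVlt => /predU1P[->|ab].
  by rewrite /mu lebesgue_measure_itv /= lte_fin ltxx subrr.
by rewrite /mu lebesgue_measure_itv /= lte_fin ab.
Qed.

Lemma cst_integrable_itv (a b c : R) : a <= b -> mu.-integrable `]a, b] (EFin \o cst c).
Proof.
move=> ab; apply: measurable_bounded_integrable => //=.
- by rewrite [X in (X < _)%E](mu_itv ab) ltry.
- by apply: bounded_cst.
Qed.

Lemma ni_integrable_pos (a b : R) : 0 < a -> a <= b -> b <= 1 ->
  mu.-integrable `]a, b] (EFin \o f).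
Proof.
move=> a0 ab b1; apply: measurable_bounded_integrable => //=.
- by rewrite [X in (X < _)%E](mu_itv ab) ltry.
- exact: (ni_measurable (ltW a0) b1).
- exists (`|f a| + `|f b|); split; first exact: num_real.
  move=> M hM x /=; rewrite in_itv /= => /andP[ax xb].
  apply: le_trans (ltW hM).
  have h1 : f x <= f a by apply: f_ni => //; [exact: ltW|exact: le_trans xb b1].
  have h2 : f b <= f x by apply: f_ni => //; exact: lt_trans a0 ax.
  rewrite ler_norml; have := ler_norm (f a); have := ler_norm (- f b).
  rewrite normrN; have := normr_ge0 (f a); have := normr_ge0 (f b).
  by move=> *; apply/andP; split; lra.
Qed.

Lemma Rintegral_cst_itv (a b c : R) : a <= b -> \int[mu]_(x in `]a, b]) c = c * (b - a).
Proof. by move=> ab; rewrite Rintegral_cst // [X in fine X](mu_itv ab). Qed.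

Lemma ni_integral_le a b : 0 < a -> a <= b -> b <= 1 -> J a b <= (b - a) * f a.
Proof.
move=> a0 ab b1; rewrite mulrC -Rintegral_cst_itv //.
apply: le_Rintegral => //; first exact: ni_integrable_pos.
  exact: cst_integrable_itv.
move=> x /=; rewrite in_itv /= => /andP[ax xb].
by apply: f_ni => //; [exact: ltW|exact: le_trans xb b1].
Qed.

Lemma ni_integral_ge a b : 0 <= a -> a <= b -> b <= 1 ->
  mu.-integrable `]a, b] (EFin \o f) -> (b - a) * f b <= J a b.
Proof.
move=> a0 ab b1 fi; rewrite mulrC -Rintegral_cst_itv //.
apply: le_Rintegral => //; first exact: cst_integrable_itv.
move=> x /=; rewrite in_itv /= => /andP[ax xb].
by apply: f_ni => //; exact: le_lt_trans a0 ax.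
Qed.

Lemma integral_itv_split (a b c : R) : a <= b -> b <= c ->
  mu.-integrable `]a, c] (EFin \o f) -> J a c = J a b + J b c.
Proof.
move=> ab bc fi; rewrite /J -(@Rintegral_itvB _ f (BRight a) (BRight c) b) //.
by rewrite addrC subrK.
Qed.

(** On []0, s]] one has [f >= f s >= 0], so monotone convergence along []s / n.+1, s]] turns a bound
    on the truncated integrals into integrability; on []s, 1]] the function is bounded. *)
Lemma ni_integrable_bounded s M : 0 < s -> s <= 1 -> 0 <= f s ->
  (forall d, 0 < d -> d <= s -> J d s <= M) ->
  mu.-integrable `]0, 1] (EFin \o f) /\ J 0 s <= M.
Proof.
move=> s0 s1 fs hM.
pose D n := `]s / n.+1%:R, s]%classic : set R.
have n0 n : 0 < n.+1%:R :> R by rewrite ltr0n.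
have n1 n : 1 <= n.+1%:R :> R by rewrite ler1n.
have sn n : 0 < s / n.+1%:R by rewrite divr_gt0.
have sns n : s / n.+1%:R <= s by rewrite ler_pdivrMr // ler_peMr // ltW.
have DU : \bigcup_n D n = `]0, s]%classic.
  apply/seteqP; split => [x [n _]|x] /=; rewrite /D /= !in_itv /=.
    by move=> /andP[h ->]; rewrite (lt_trans (sn n) h).
  move=> /andP[x0 xs].
  pose m := Num.bound (s / x).
  have hm := archi_boundP (divr_ge0 (ltW s0) (ltW x0)).
  exists m => //=; rewrite in_itv /= xs andbT.
  rewrite ltr_pdivrMr // mulrC -ltr_pdivrMr //; apply: lt_trans hm _.
  by rewrite ltr_nat.
have f0 x : 0 < x -> x <= s -> 0 <= f x.
  by move=> x0 xs; apply: (le_trans fs); apply: f_ni.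
have c : (\int[mu]_(x in D n) (f x)%:E @[n --> \oo] --> \int[mu]_(x in `]0%R, s]) (f x)%:E)%E.
  rewrite -DU; apply: ge0_nondecreasing_set_cvg_integral.
  - move=> m n mn; apply/subsetPset => x /=; rewrite /D /= !in_itv /=.
    move=> /andP[h ->]; rewrite andbT (le_lt_trans _ h) // ler_pM2l //.
    by rewrite lef_pV2 ?posrE // ler_nat.
  - by move=> n; exact: mJ.
  - move=> n; apply/measurable_EFinP; apply: ni_measurable => //; exact: ltW.
  - move=> n x; rewrite /D /= in_itv /= => /andP[h xs]; rewrite lee_fin.
    by apply: f0 => //; exact: lt_trans (sn n) h.
have le : (\int[mu]_(x in `]0%R, s]) (f x)%:E <= M%:E)%E.
  rewrite -(cvg_lim _ c) //; apply: lime_le; first by apply/cvg_ex; eexists; exact: c.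
  apply: nearW => n.
  have fi : mu.-integrable (D n) (EFin \o f) by exact: ni_integrable_pos.
  have := hM _ (sn n) (sns n); rewrite -lee_fin /J /Rintegral fineK //.
  exact: integrable_fin_num.
have ge : (0 <= \int[mu]_(x in `]0%R, s]) (f x)%:E)%E.
  by apply: integral_ge0 => x /=; rewrite in_itv /= => /andP[x0 xs]; rewrite lee_fin f0.
have fi0 : mu.-integrable `]0, s] (EFin \o f).
  apply/integrableP; split.
    by apply/measurable_EFinP; exact: ni_measurable.
  apply: le_lt_trans (ltry M); apply: le_trans le.
  rewrite le_eqVlt; apply/orP; left; apply/eqP; apply: eq_integral => x.
  rewrite inE /= in_itv /= => /andP[x0 xs]; by rewrite ger0_norm // f0.
split.
  have -> : `]0, 1]%classic = `]0, s] `|` `]s, 1] :> set R.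
    by apply: itv_bndbnd_setU; rewrite bnd_simp // ltW.
  apply: integrable_setU => //; last exact: ni_integrable_pos.
  apply/disj_setPS => x [] /=; rewrite !in_itv /= => /andP[_ xs] /andP[sx _].
  by move: xs; rewrite leNgt sx.
by rewrite /J /Rintegral -lee_fin fineK //; exact: integrable_fin_num.
Qed.

End MonotoneIntegral.

(** * The integral functional *)

Section Dilation.
Variables (R : realType) (h : R -> R).
Hypotheses (h_concave : concave_pos h)
  (h_nd : forall x y, 0 < x -> x <= y -> h x <= h y)
  (h1 : h 1 = 0) (h_le : forall x, 0 < x -> h x <= x - 1).
Let mu := @lebesgue_measure R.

(** For [s = 1] this is the criterion of the theorem; for [s = c^-1] the integrand is that of the
    equation for [c]. *)
Definition dilation_integrable (s : R) : Prop :=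
  mu.-integrable `]0, 1] (EFin \o (fun x => h (s / x))).

Lemma dilation_ni s : 0 < s ->
  forall x y, 0 < x -> x <= y -> y <= 1 -> h (s / y) <= h (s / x).
Proof.
move=> s0 x y x0 xy _; have y0 := lt_le_trans x0 xy.
by apply: h_nd; [rewrite divr_gt0|rewrite ler_pM2l // lef_pV2 ?posrE].
Qed.

Lemma h_le0 x : 0 < x -> x <= 1 -> h x <= 0.
Proof. by move=> x0 x1; rewrite -h1; exact: h_nd. Qed.

Lemma h_ge0 x : 1 <= x -> 0 <= h x.
Proof. by move=> x1; rewrite -h1; exact: h_nd. Qed.

(** From below [h (t * y) >= h t]; from above [t <= k * s] with [k = 1 + t / s], and
    [concave_pos_growth] applies because [k >= 1]. With [y = x^-1] this dominates one dilation by
    another, so integrability does not depend on [s]. *)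
Lemma dilation_bound s t y : 0 < s -> 0 < t -> 1 <= y ->
  `|h (t * y)| <= 2 * (1 + t / s) * `|h (s * y)| +
    (`|h (2 * (1 + t / s))| + `|h t|).
Proof.
move=> s0 t0 y1; have y0 : 0 < y by lra.
have ts : 0 < t / s by rewrite divr_gt0.
set k := 1 + t / s.
have k1 : 1 <= k by rewrite /k; lra.
have lo : h t <= h (t * y) by apply: h_nd => //; rewrite ler_pMr.
have sy0 : 0 < s * y by rewrite mulr_gt0.
have up : h (t * y) <= 2 * k * `|h (s * y)| + `|h (2 * k)|.
  apply: le_trans (concave_pos_growth h_concave h1 h_nd k1 sy0).
  apply: h_nd; first by rewrite mulr_gt0.
  have -> : k * (s * y) = s * y + t * y by rewrite /k; field; rewrite gt_eqF.
  by rewrite lerDr ltW.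
have n1 : 0 <= 2 * k * `|h (s * y)| by rewrite mulr_ge0 //; lra.
have n2 := normr_ge0 (h (2 * k)); have n3 := normr_ge0 (h t).
have n4 := ler_norm (- h t); rewrite normrN in n4.
by rewrite ler_norml; apply/andP; split; lra.
Qed.

Lemma dilation_integrable_transfer s t : 0 < s -> 0 < t ->
  dilation_integrable s -> dilation_integrable t.
Proof.
move=> s0 t0 si.
pose a := 2 * (1 + t / s).
pose K := `|h (2 * (1 + t / s))| + `|h t|.
have a0 : 0 <= a by rewrite mulr_ge0 // addr_ge0 // divr_ge0 // ltW.
have gi : mu.-integrable `]0, 1]
    ((fun x => a%:E * `|(h (s / x))%:E|) \+ (EFin \o cst K))%E.
  apply: integrableD => //; last exact: cst_integrable_itv.
  by apply: integrableZl => //; exact: integrable_abse si.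
apply: le_integrable gi => //.
  apply/measurable_EFinP; apply: ni_measurable => //; exact: dilation_ni.
move=> x /=; rewrite in_itv /= => /andP[x0 x1].
rewrite -?EFinM -?EFinD ?lee_fin.
have y1 : 1 <= x^-1 by rewrite invf_ge1.
apply: le_trans (dilation_bound s0 t0 y1) _.
by rewrite ler_norm.
Qed.

Definition dilation_integral (s : R) : R := \int[mu]_(x in `]0, 1]) h (s / x).

Lemma dilation_integral_nd : dilation_integrable 1 ->
  forall s t, 0 < s -> s <= t -> dilation_integral s <= dilation_integral t.
Proof.
move=> hi s t s0 st; have t0 := lt_le_trans s0 st.
apply: le_Rintegral => //.
- exact: (dilation_integrable_transfer ltr01 s0 hi).
- exact: (dilation_integrable_transfer ltr01 t0 hi).
move=> x /=; rewrite in_itv /= => /andP[x0 _].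
by apply: h_nd; [rewrite divr_gt0|rewrite ler_pM2r ?invr_gt0].
Qed.

Lemma dilation_integral_concave : dilation_integrable 1 ->
  concave_pos dilation_integral.
Proof.
move=> hi s t l s0 t0 l0 l1.
have si := dilation_integrable_transfer ltr01 s0 hi.
have ti := dilation_integrable_transfer ltr01 t0 hi.
have [->|l0'] := eqVneq l 0.
  by rewrite !mul0r !add0r subr0 !mul1r.
have lgt : 0 < l by rewrite lt_neqAle eq_sym l0'.
have z0 : 0 < l * s + (1 - l) * t.
  by rewrite ltr_wpDr ?mulr_gt0 // mulr_ge0 ?subr_ge0 // ltW.
have zi := dilation_integrable_transfer ltr01 z0 hi.
have m01 : measurable (`]0, 1]%classic : set (measurableTypeR R)) by exact: measurable_itv.
have lsi : mu.-integrable `]0, 1] (EFin \o (fun x => l * h (s / x))).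
  by apply: (eq_integrable m01 _ _ _ (integrableZl m01 l si)) => x _ /=; rewrite EFinM.
have lti : mu.-integrable `]0, 1] (EFin \o (fun x => (1 - l) * h (t / x))).
  by apply: (eq_integrable m01 _ _ _ (integrableZl m01 (1 - l) ti)) => x _ /=; rewrite EFinM.
rewrite /dilation_integral -!RintegralZl // -RintegralD //.
apply: le_Rintegral => //.
  by apply: (eq_integrable m01 _ _ _ (integrableD m01 lsi lti)) => x _ /=; rewrite EFinD.
move=> x /=; rewrite in_itv /= => /andP[x0 _].
have -> : (l * s + (1 - l) * t) / x = l * (s / x) + (1 - l) * (t / x) by ring.
by apply: h_concave => //; rewrite divr_gt0.
Qed.

Lemma dilation_integral_lt0 : dilation_integrable 1 ->
  exists2 a, 0 < a & dilation_integral a < 0.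
Proof.
move=> hi.
(* The integral of [h (1 / x)] over [(0, d]] is small for some [d]: otherwise
   the integrals over [(d, 1 / 2]] would stay away from the one over
   [(0, 1 / 2]]. *)
have [d [d0 d1 hd]] : exists d, [/\ 0 < d, d <= 1 / 2 &
    \int[mu]_(x in `]0, d]) h (1 / x) < 1 / 4].
  apply: contrapT => nd.
  have big d : 0 < d -> d <= 1 / 2 -> 1 / 4 <= \int[mu]_(x in `]0, d]) h (1 / x).
    by move=> d0 d1; rewrite leNgt; apply/negP => hd; apply: nd; exists d.
  have f0 : 0 <= h (1 / (1 / 2)) by apply: h_ge0; rewrite ler_pdivlMr; lra.
  have i2 : mu.-integrable `]0, 1 / 2] (EFin \o (fun x => h (1 / x))).
    apply: integrableS hi => //= x /=; rewrite !in_itv /= => /andP[-> xs].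
    by apply: (le_trans xs); lra.
  have bnd d : 0 < d -> d <= 1 / 2 -> \int[mu]_(x in `]d, 1 / 2]) h (1 / x) <=
      \int[mu]_(x in `]0, 1 / 2]) h (1 / x) - 1 / 4.
    move=> d0 d1; rewrite (integral_itv_split (ltW d0) d1 i2).
    by move: (big d d0 d1); move: (\int[mu]_(x in `]0, d]) _) => u; lra.
  have d0 : 0 < 1 / 2 :> R by lra.
  have d1 : 1 / 2 <= 1 :> R by lra.
  have [_] := ni_integrable_bounded (dilation_ni ltr01) d0 d1 f0 bnd.
  by rewrite leNgt gtrDl oppr_lt0 => /negP; apply; lra.
have d01 : d <= 1 by move: d0 d1 {hd}; lra.
have s0 : 0 < d / 4 by move: d0 {hd}; lra.
have s1 : d / 4 <= 1 by move: d01 {hd}; lra.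
(* Over []0, d]] the integral is below [1 / 4]. Over []d, 1]], of length at least [1 / 2], the
   integrand is at most [h (1 / 4) <= - (3 / 4)], and [1 / 4 - 3 / 8 < 0]. *)
exists (d / 4) => //; move: hd.
have si := dilation_integrable_transfer ltr01 s0 hi.
rewrite /dilation_integral (integral_itv_split (ltW d0) d01 si).
have lo : \int[mu]_(x in `]0, d]) h (d / 4 / x) <= \int[mu]_(x in `]0, d]) h (1 / x).
  have sub : `]0, d] `<=` (`]0, 1] : set R).
    move=> x /=; rewrite !in_itv /= => /andP[-> xs]; exact: le_trans xs d01.
  apply: le_Rintegral => //; [exact: integrableS si|exact: integrableS hi|].
  move=> x /=; rewrite in_itv /= => /andP[x0 _].
  by apply: h_nd; [rewrite divr_gt0|rewrite ler_pM2r ?invr_gt0].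
have hi' := @ni_integral_le R (fun x => h (d / 4 / x)) (dilation_ni s0) d 1 d0 d01 (lexx 1).
have : h (d / 4 / d) <= - (3 / 4).
  have -> : d / 4 / d = 1 / 4 by field; rewrite gt_eqF.
  by apply: le_trans (h_le _) _; lra.
move: hi' lo; move: (h (d / 4 / d)) (Rintegral _ _ _) (Rintegral _ _ _) (Rintegral _ _ _).
by move=> v u w z; nra.
Qed.

End Dilation.

(** * Reciprocal sums as Riemann sums of the integral *)

Section IntegralFunctional.
Variables (R : realType) (h : R -> R) (lam : nat -> R).
Hypotheses (h_concave : concave_pos h)
  (h_nd : forall x y, 0 < x -> x <= y -> h x <= h y) (h1 : h 1 = 0).
Hypotheses (lam_W0 : W0 lam)
  (lam_oo : partial_weight lam n @[n --> \oo] --> +oo).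
Let mu := @lebesgue_measure R.
Let L := partial_weight lam.
Let L0 n : 0 < L n := partial_weight_gt0 lam_W0 n.

Let LS n : L n.+1 = L n + lam n.+1 := partial_weightS lam n.

Let ratio i n : (i <= n)%N -> L i / L n <= 1.
Proof. by move=> ni; rewrite ler_pdivrMr // mul1r; exact: partial_weight_nd. Qed.

Let arg s i n : s / (L i / L n) = s * L n / L i.
Proof. by field; rewrite !gt_eqF. Qed.

(** After division by [L n], this is the lower Riemann sum of [h (s / x)] for the partition of []0,
    1]] by the points [L j / L n]. *)
Lemma reciprocal_sum_le_integral : dilation_integrable h 1 ->
  forall s n, 0 < s -> reciprocal_sum lam h s n <= L n * dilation_integral h s.
Proof.
move=> hi s n s0.
have si := dilation_integrable_transfer h_concave h_nd h1 ltr01 s0 hi.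
have ni := dilation_ni h_nd s0.
have sub a b : 0 <= a -> b <= 1 -> mu.-integrable `]a, b] (EFin \o (fun x => h (s / x))).
  move=> a0 b1; apply: integrableS si => //= x /=; rewrite !in_itv /= => /andP[ax xb].
  by rewrite (le_lt_trans a0 ax) (le_trans xb b1).
have part j : (j <= n)%N -> \sum_(i < j.+1) lam i * h (s * L n / L i) <=
    L n * \int[mu]_(x in `]0, L j / L n]) h (s / x).
  elim: j => [_|j IH jn].
    rewrite big_ord_recl big_ord0 addr0 /= -(partial_weight0 lam) -arg.
    have H := ni_integral_ge ni (lexx 0) (ltW (divr_gt0 (L0 0) (L0 n))) (ratio (leq0n n))
      (sub _ _ (lexx 0) (ratio (leq0n n))).
    apply: (le_trans _ (ler_wpM2l (ltW (L0 n)) H)).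
    rewrite le_eqVlt; apply/orP; left.
    by apply/eqP; rewrite subr0 mulrA [L n * _]mulrC divfK // gt_eqF.
  have LjS : L j / L n <= L j.+1 / L n.
    by rewrite ler_pM2r ?invr_gt0 //; exact: partial_weight_nd.
  have Lj0 : 0 <= L j / L n by rewrite ltW // divr_gt0.
  rewrite big_ord_recr /= (integral_itv_split Lj0 LjS (sub _ _ (lexx 0) (ratio jn))).
  rewrite mulrDr; apply: lerD; first exact: IH (ltnW jn).
  have H := ni_integral_ge ni Lj0 LjS (ratio jn) (sub _ _ Lj0 (ratio jn)).
  apply: (le_trans _ (ler_wpM2l (ltW (L0 n)) H)).
  rewrite le_eqVlt; apply/orP; left.
  rewrite arg mulrA; apply/eqP; congr (_ * _); rewrite LS.
  by field; rewrite gt_eqF.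
by have := part n (leqnn n); rewrite divff ?gt_eqF.
Qed.

Hypothesis lam_ratio0 : lam n / partial_weight lam n @[n --> \oo] --> (0 : R).

(** The integral is below the Riemann sum with left endpoints, while [T] uses right endpoints.
    Raising [s] to [t] pays for the change: [lam j.+1 / L j.+1 < 1 - s / t] gives
    [s / L j <= t / L j.+1]. *)
Lemma reciprocal_sum_gt_integral s t d : 0 < s -> s < t ->
  0 < d -> d <= 1 -> d <= s -> 0 < \int[mu]_(x in `]d, 1]) h (s / x) ->
  \forall n \near \oo, 0 < reciprocal_sum lam h t n.
Proof.
move=> s0 st d0 d1 ds int0.
have t0 := lt_trans s0 st.
have ni := dilation_ni h_nd s0.
have e0 : 0 < 1 - s / t by rewrite subr_gt0 ltr_pdivrMr // mul1r.
have [i0 _ hi0] := cvgr_lt _ lam_ratio0 _ e0.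
have [n1 _ hn1] := (cvgryPge _).1 lam_oo (L i0 / d).
exists (maxn i0 n1) => // n /=; rewrite geq_max => /andP[i0n n1n].
have Ld : L i0 / L n <= d.
  by rewrite ler_pdivrMr // mulrC -ler_pdivrMr //; exact: hn1.
have u0 i : 0 < L i / L n by rewrite divr_gt0.
have u_nd i j : (i <= j)%N -> L i / L n <= L j / L n.
  by move=> ij; rewrite ler_pM2r ?invr_gt0 //; exact: partial_weight_nd.
(* At [j = i0] the integral is empty, and the terms up to [i0] are nonnegative because
   [L i / L n <= d <= t]. *)
have part j : (i0 <= j)%N -> (j <= n)%N ->
    L n * \int[mu]_(x in `]L i0 / L n, L j / L n]) h (s / x) <=
    \sum_(i < j.+1) lam i * h (t * L n / L i).
  elim: j => [|j IH].
    rewrite leqn0 => /eqP i00 _; rewrite i00 set_itv_ge ?bnd_simp ?ltxx //.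
    rewrite Rintegral_set0 mulr0 big_ord_recl big_ord0 addr0 mulr_ge0 ?(lam_ge0 lam_W0) //.
    apply: (h_ge0 h_nd h1); rewrite -arg ler_pdivlMr // mul1r.
    by apply: le_trans (ltW st); apply: le_trans ds; move: Ld; rewrite i00.
  rewrite leq_eqVlt => /predU1P[i0j jn|i0j jn].
    rewrite -i0j set_itv_ge ?bnd_simp ?ltxx // Rintegral_set0 mulr0.
    apply: sumr_ge0 => i _; rewrite mulr_ge0 ?(lam_ge0 lam_W0) //.
    apply: (h_ge0 h_nd h1); rewrite -arg ler_pdivlMr // mul1r.
    apply: le_trans (ltW st); apply: le_trans ds; apply: le_trans Ld.
    by apply: u_nd; rewrite -ltnS; exact: ltn_ord.
  rewrite ltnS in i0j.
  have si : mu.-integrable `]L i0 / L n, L j.+1 / L n] (EFin \o (fun x => h (s / x))).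
    by apply: (ni_integrable_pos ni) => //; [exact: u_nd (leqW i0j)|exact: ratio].
  rewrite (integral_itv_split (u_nd _ _ i0j) (u_nd _ _ (leqnSn j)) si).
  rewrite mulrDr [leRHS]big_ord_recr /=; apply: lerD; first exact: IH i0j (ltnW jn).
  have H := ni_integral_le ni (u0 j) (u_nd _ _ (leqnSn j)) (ratio jn).
  apply: (le_trans (ler_wpM2l (ltW (L0 n)) H)).
  have -> : L n * ((L j.+1 / L n - L j / L n) * h (s / (L j / L n))) =
      lam j.+1 * h (s / (L j / L n)).
    rewrite mulrA; congr (_ * _); rewrite LS.
    by field; rewrite gt_eqF.
  apply: ler_wpM2l; first exact: lam_ge0.
  apply: h_nd; first by rewrite divr_gt0.
  rewrite -arg ler_pdivrMr // mulrAC ler_pdivlMr //.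
  have : lam j.+1 / L j.+1 < 1 - s / t by exact: hi0 (leqW i0j).
  rewrite ltr_pdivrMr // => /ltW.
  have -> : (1 - s / t) * L j.+1 = L j.+1 - s * L j.+1 / t by ring.
  rewrite LS => hl.
  have : s * (L j + lam j.+1) / t <= L j by lra.
  rewrite ler_pdivrMr // => hl'.
  by rewrite !mulrA ler_pM2r ?invr_gt0 // [t * _]mulrC.
have Ln0 := L0 n.
have fin := part n i0n (leqnn n); rewrite divff ?gt_eqF // in fin.
apply: lt_le_trans fin; rewrite pmulr_rgt0 //.
have si : mu.-integrable `]L i0 / L n, 1] (EFin \o (fun x => h (s / x))).
  by apply: (ni_integrable_pos ni) => //; exact: ratio.
rewrite (integral_itv_split Ld d1 si) ltr_wpDl //.
apply: Rintegral_ge0 => x /=; rewrite in_itv /= => /andP[ux xd].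
have x0 := lt_trans (u0 i0) ux.
by apply: (h_ge0 h_nd h1); rewrite ler_pdivlMr // mul1r (le_trans xd).
Qed.

(** The previous lemma forces every integral over []d, 1]] with small [d] to be nonpositive. As the
    integrand is nonnegative near 0, this bound yields integrability, and then the sign of the full
    integral. *)
Lemma integral_le0_of_reciprocal_sum s t : 0 < s -> s < t ->
  ~ (\forall n \near \oo, 0 < reciprocal_sum lam h t n) ->
  dilation_integrable h 1 /\ dilation_integral h s <= 0.
Proof.
move=> s0 st nT; have ni := dilation_ni h_nd s0.
pose m := Num.min s 1.
have m0 : 0 < m by rewrite lt_min s0 ltr01.
have m1 : m <= 1 by rewrite ge_min lexx orbT.
have ms : m <= s by rewrite ge_min lexx.
have le0 d : 0 < d -> d <= m -> \int[mu]_(x in `]d, 1]) h (s / x) <= 0.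
  move=> d0 dm; rewrite leNgt; apply/negP => i0; apply: nT.
  by apply: (reciprocal_sum_gt_integral s0 st d0 _ _ i0); exact: le_trans dm _.
have fm : 0 <= h (s / m) by apply: (h_ge0 h_nd h1); rewrite ler_pdivlMr // mul1r.
have bnd d : 0 < d -> d <= m -> \int[mu]_(x in `]d, m]) h (s / x) <=
    - \int[mu]_(x in `]m, 1]) h (s / x).
  move=> d0 dm; have := le0 d d0 dm.
  rewrite (integral_itv_split dm m1 (ni_integrable_pos ni d0 (le_trans dm m1) (lexx 1))).
  by rewrite -lerBrDr sub0r.
have [si le] := ni_integrable_bounded ni m0 m1 fm bnd.
split; first exact: (dilation_integrable_transfer h_concave h_nd h1 s0 ltr01 si).
by rewrite /dilation_integral (integral_itv_split (ltW m0) m1 si) -lerBrDr sub0r.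
Qed.

End IntegralFunctional.

(** * The series functional *)

Section SeriesFunctional.
Variables (R : realType) (h : R -> R) (eta : R).
Hypotheses (h_concave : concave_pos h)
  (h_nd : forall x y, 0 < x -> x <= y -> h x <= h y)
  (h1 : h 1 = 0) (h_le : forall x, 0 < x -> h x <= x - 1).
Hypotheses (eta_gt0 : 0 < eta) (eta_lt1 : eta < 1).
Let mu := @lebesgue_measure R.
Let q := 1 - eta.
Let q0 : 0 < q. Proof. by rewrite subr_gt0. Qed.
Let q1 : q < 1. Proof. by rewrite gtrBl. Qed.
Let qk0 k : 0 < q ^+ k. Proof. exact: exprn_gt0. Qed.
Let qk1 k : q ^+ k <= 1. Proof. by rewrite exprn_ile1 // ltW. Qed.
Let qkS k : q ^+ k.+1 <= q ^+ k.
Proof. by rewrite exprS ger_pMl // ltW. Qed.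

Definition dilation_term (s : R) (k : nat) : R := q ^+ k * h (s / q ^+ k).

Lemma expr_small d : 0 < d -> exists k, q ^+ k <= d.
Proof.
move=> d0; have /cvgr_lt : q ^+ n @[n --> \oo] --> (0 : R).
  by apply: cvg_expr; rewrite ger0_norm ?ltW.
by move=> /(_ _ d0)[k _ hk]; exists k; apply/ltW/hk => /=.
Qed.

(** On []q ^+ i.+1, q ^+ i]], of length [(1 - q) * q ^+ i], the integrand is at least its value at
    the right endpoint. *)
Lemma partial_sum_le_integral s k : 0 < s ->
  (1 - q) * \sum_(i < k) dilation_term s i <= \int[mu]_(x in `]q ^+ k, 1]) h (s / x).
Proof.
move=> s0; have ni := dilation_ni h_nd s0.
elim: k => [|k IH].
  by rewrite big_ord0 mulr0 expr0 set_itv_ge ?bnd_simp ?ltxx // Rintegral_set0.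
rewrite (integral_itv_split (qkS k) (qk1 k) (ni_integrable_pos ni (qk0 _) (qk1 _) (lexx 1))).
rewrite big_ord_recr mulrDr addrC /=; apply: lerD => //.
have H := ni_integral_ge ni (ltW (qk0 k.+1)) (qkS k) (qk1 k)
  (ni_integrable_pos ni (qk0 k.+1) (qkS k) (qk1 k)).
apply: le_trans H; rewrite le_eqVlt; apply/orP; left; apply/eqP.
by rewrite /dilation_term exprS; ring.
Qed.

(** With left endpoints the value on the cell [i] belongs to the term [i.+1]: this accounts for the
    factor [q] and for the removal of the term [h s] of index 0. *)
Lemma integral_le_partial_sum s k : 0 < s ->
  q * \int[mu]_(x in `]q ^+ k, 1]) h (s / x) <=
  (1 - q) * (\sum_(i < k.+1) dilation_term s i - h s).
Proof.
move=> s0; have ni := dilation_ni h_nd s0.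
elim: k => [|k IH].
  rewrite expr0 set_itv_ge ?bnd_simp ?ltxx // Rintegral_set0 mulr0.
  by rewrite big_ord_recl big_ord0 /dilation_term expr0 divr1 mul1r addr0 subrr mulr0.
rewrite (integral_itv_split (qkS k) (qk1 k) (ni_integrable_pos ni (qk0 _) (qk1 _) (lexx 1))).
rewrite [in leRHS]big_ord_recr /= [_ + dilation_term _ _]addrC -addrA.
rewrite [in leLHS]mulrDr [in leRHS]mulrDr; apply: lerD => //.
have H := ni_integral_le ni (qk0 k.+1) (qkS k) (qk1 k).
apply: le_trans (ler_wpM2l (ltW q0) H) _.
rewrite le_eqVlt; apply/orP; left; apply/eqP.
by rewrite /dilation_term !exprS; ring.
Qed.

Let geo : cvgn (series (fun k => q ^+ k)).
Proof.
have := @is_cvg_geometric_series R 1 q; rewrite ger0_norm ?ltW // => /(_ q1).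
by rewrite (_ : geometric 1 q = (fun k => q ^+ k)) //; apply/funext => k /=; rewrite mul1r.
Qed.


Lemma dilation_series_cvg s : 0 < s -> dilation_integrable h s ->
  cvgn (series (dilation_term s)).
Proof.
move=> s0 si; have ni := dilation_ni h_nd s0.
have eta0 : 0 < 1 - q by rewrite subr_gt0.
(* Subtracting a convergent geometric series makes the terms nonnegative, so bounded partial sums
   suffice. *)
pose v k := dilation_term s k - q ^+ k * h s.
have v0 k : 0 <= v k.
  rewrite /v /dilation_term -mulrBr mulr_ge0 ?(ltW (qk0 k)) // subr_ge0; apply: h_nd => //.
  by rewrite ler_pdivlMr // ger_pMr.
have cv : cvgn (series v).
  apply: nondecreasing_is_cvgn.
    apply/nondecreasing_seqP => n; rewrite /series /= big_nat_recr //= lerDl.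
    exact: v0.
  exists ((dilation_integral h s - h s) / (1 - q)) => _ [n _ <-].
  rewrite /series /= big_mkord ler_pdivlMr // mulrC.
  have -> : (1 - q) * \sum_(i < n) v i =
      (1 - q) * \sum_(i < n) dilation_term s i - (1 - q ^+ n) * h s.
    rewrite /v sumrB mulrBr; congr (_ - _); rewrite -mulr_suml mulrA; congr (_ * _).
    elim: n => [|n IHn]; first by rewrite big_ord0 mulr0 expr0 subrr.
    by rewrite big_ord_recr mulrDr IHn /= exprS; ring.
  have H := partial_sum_le_integral n s0.
  have si0 : mu.-integrable `]0, q ^+ n] (EFin \o (fun x => h (s / x))).
    apply: integrableS si => //= x /=; rewrite !in_itv /= => /andP[-> xq].
    exact: le_trans xq (qk1 n).
  have e := integral_itv_split (ltW (qk0 n)) (qk1 n) si.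
  have H2 := ni_integral_ge ni (lexx 0) (ltW (qk0 n)) (qk1 n) si0.
  have H3 : h s <= h (s / q ^+ n).
    by apply: h_nd => //; rewrite ler_pdivlMr // ger_pMr.
  have H4 := ler_wpM2l (ltW (qk0 n)) H3.
  rewrite /dilation_integral e; rewrite subr0 in H2.
  move: H H2 H4; move: (Rintegral _ _ _) (Rintegral _ _ _) (\sum_(i < n) _) (h _) (h _).
  by move=> a b c x y; nra.
have -> : dilation_term s = v \+ (fun k => q ^+ k * h s).
  by apply/funext => k; rewrite /= /v subrK.
apply: is_cvg_seriesD => //.
have -> : (fun k => q ^+ k * h s) = h s *: (fun k => q ^+ k).
  by apply/funext => k; rewrite mulrC.
by apply: is_cvg_seriesZ; exact: geo.
Qed.

(** The converse comparison: by [integral_le_partial_sum] the truncated integrals are bounded. Thus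
    the same integrability criterion governs the series. *)
Lemma dilation_integrable_partial_sums s M : 0 < s ->
  (forall k, \sum_(i < k) dilation_term s i <= M) -> dilation_integrable h s.
Proof.
move=> s0 hM; have ni := dilation_ni h_nd s0.
pose m := Num.min s 1.
have m0 : 0 < m by rewrite lt_min s0 ltr01.
have m1 : m <= 1 by rewrite ge_min lexx orbT.
have ms : m <= s by rewrite ge_min lexx.
have fm : 0 <= h (s / m) by apply: (h_ge0 h_nd h1); rewrite ler_pdivlMr // mul1r.
have eta0 : 0 < 1 - q by rewrite subr_gt0.
suff bnd d : 0 < d -> d <= m -> \int[mu]_(x in `]d, m]) h (s / x) <=
    (1 - q) * (M - h s) / q - \int[mu]_(x in `]m, 1]) h (s / x).
  by have [] := ni_integrable_bounded ni m0 m1 fm bnd.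
move=> d0 dm; have [k kd] := expr_small d0.
have km := le_trans kd dm.
have i1 : mu.-integrable `]q ^+ k, 1] (EFin \o (fun x => h (s / x))).
  exact: (ni_integrable_pos ni).
have i2 : mu.-integrable `]q ^+ k, m] (EFin \o (fun x => h (s / x))).
  exact: (ni_integrable_pos ni).
have e1 := integral_itv_split km m1 i1.
have e2 := integral_itv_split kd dm i2.
have pos : 0 <= \int[mu]_(x in `]q ^+ k, d]) h (s / x).
  apply: Rintegral_ge0 => x /=; rewrite in_itv /= => /andP[qx xd].
  have x0 := lt_trans (qk0 k) qx.
  by apply: (h_ge0 h_nd h1); rewrite ler_pdivlMr // mul1r (le_trans xd) // (le_trans dm).
have H := integral_le_partial_sum k s0.
have H' : \int[mu]_(x in `]q ^+ k, 1]) h (s / x) <= (1 - q) * (M - h s) / q.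
  rewrite ler_pdivlMr // mulrC; apply: (le_trans H).
  by rewrite ler_pM2l // lerD2r.
rewrite lerBrDr; apply: le_trans H'; rewrite e1 e2.
by rewrite lerD2r lerDr.
Qed.

Definition dilation_series (s : R) : R := limn (series (dilation_term s)).

Let transfer s t : 0 < s -> 0 < t -> dilation_integrable h s -> dilation_integrable h t :=
  @dilation_integrable_transfer R h h_concave h_nd h1 s t.

Section Integrable.
Hypothesis hi : dilation_integrable h 1.

Let cvgs s : 0 < s -> series (dilation_term s) n @[n --> \oo] --> dilation_series s.
Proof. by move=> s0; apply: dilation_series_cvg => //; exact: transfer hi. Qed.

Lemma dilation_series_nd s t : 0 < s -> s <= t ->
  dilation_series s <= dilation_series t.
Proof.
move=> s0 st; have t0 := lt_le_trans s0 st.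
apply: (ler_cvg_to (cvgs s0) (cvgs t0)); apply: nearW => n.
apply: ler_sum => i _; rewrite ler_pM2l //.
by apply: h_nd; [rewrite divr_gt0|rewrite ler_pM2r ?invr_gt0].
Qed.

Lemma dilation_series_concave : concave_pos dilation_series.
Proof.
move=> s t l s0 t0 l0 l1.
have [->|l0'] := eqVneq l 0; first by rewrite !mul0r !add0r subr0 !mul1r.
have lgt : 0 < l by rewrite lt_neqAle eq_sym l0'.
have z0 : 0 < l * s + (1 - l) * t.
  by rewrite ltr_wpDr ?mulr_gt0 // mulr_ge0 ?subr_ge0 // ltW.
have c : l * series (dilation_term s) n + (1 - l) * series (dilation_term t) n @[n --> \oo]
    --> l * dilation_series s + (1 - l) * dilation_series t.
  by apply: cvgD; apply: cvgMr; exact: cvgs.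
apply: (ler_cvg_to c (cvgs z0)); apply: nearW => n.
rewrite /series /= !mulr_sumr -big_split /=; apply: ler_sum => k _.
rewrite /dilation_term !(mulrCA _ (q ^+ k)) -mulrDr ler_pM2l //.
have -> : (l * s + (1 - l) * t) / q ^+ k = l * (s / q ^+ k) + (1 - l) * (t / q ^+ k).
  by ring.
by apply: h_concave => //; rewrite divr_gt0.
Qed.

Lemma dilation_series_rec s : 0 < s ->
  dilation_series s = h s + q * dilation_series (s / q).
Proof.
move=> s0; have sq0 : 0 < s / q by rewrite divr_gt0.
have c : h s + q * series (dilation_term (s / q)) n @[n --> \oo]
    --> h s + q * dilation_series (s / q).
  by apply: cvgD; [exact: cvg_cst|apply: cvgMr; exact: cvgs].
have e n : h s + q * series (dilation_term (s / q)) n = series (dilation_term s) n.+1.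
  rewrite /series /= !big_mkord big_ord_recl mulr_sumr /dilation_term expr0 divr1 mul1r.
  congr (_ + _); apply: eq_bigr => i _; rewrite exprS mulrA; congr (_ * h _).
  by rewrite invfM mulrA.
have c1 : series (dilation_term s) n.+1 @[n --> \oo] --> h s + q * dilation_series (s / q).
  by under eq_fun do rewrite -e; exact: c.
have c2 : series (dilation_term s) n.+1 @[n --> \oo] --> dilation_series s.
  by rewrite (cvg_shiftS (series (dilation_term s))); exact: cvgs.
exact: (cvg_unique _ c2 c1).
Qed.

(** For [s <= q ^+ k] the first [k] terms are nonpositive, so [step] bounds the series at [s] by a
    multiple [q ^+ k] of a later value. With [k] large and [s <= 1 / 4], the series is at most
    [h s + q / 2], where [h s <= - (3 / 4)]. *)
Lemma dilation_series_lt0 : exists2 a, 0 < a & dilation_series a < 0.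
Proof.
have step k s : 0 < s -> s <= q ^+ k ->
    dilation_series s <= q ^+ k * dilation_series (s / q ^+ k).
  elim: k s => [|k IH] s s0 sk; first by rewrite expr0 mul1r divr1.
  have sq0 : 0 < s / q by rewrite divr_gt0.
  rewrite dilation_series_rec //.
  have hs : h s <= 0 by apply: (h_le0 h_nd h1) => //; exact: le_trans sk (qk1 _).
  have /(ler_wpM2l (ltW q0)) : dilation_series (s / q) <=
      q ^+ k * dilation_series (s / q / q ^+ k).
    by apply: IH => //; rewrite ler_pdivrMr // mulrC -exprS.
  have -> : s / q / q ^+ k = s / q ^+ k.+1 by rewrite exprS invfM mulrA.
  by rewrite exprS mulrA; lra.
pose g := `|dilation_series 1|.
have g1 : 0 < g + 1 by rewrite ltr_wpDl // normr_ge0.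
have g0 : 0 < 1 / (2 * (g + 1)) by rewrite divr_gt0 // mulr_gt0.
have [k hk] := expr_small g0.
have gk : q ^+ k * dilation_series 1 <= 1 / 2.
  apply: (@le_trans _ _ (q ^+ k * g)); first by rewrite ler_pM2l // ler_norm.
  apply: (@le_trans _ _ (1 / (2 * (g + 1)) * (g + 1))).
    by apply: ler_pM => //; [exact: ltW|exact: normr_ge0|rewrite lerDl].
  by rewrite invfM mulrA mulfVK // gt_eqF.
pose s := Num.min (q ^+ k.+1) (1 / 4).
have s0 : 0 < s by rewrite lt_min qk0 divr_gt0.
have sq : s <= q ^+ k.+1 by rewrite ge_min lexx.
have s4 : s <= 1 / 4 by rewrite ge_min lexx orbT.
exists s => //; rewrite dilation_series_rec //.
have sq0 : 0 < s / q by rewrite divr_gt0.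
have sqk : s / q <= q ^+ k by rewrite ler_pdivrMr // mulrC -exprS.
have H := step k (s / q) sq0 sqk.
have H2 : dilation_series (s / q / q ^+ k) <= dilation_series 1.
  apply: dilation_series_nd; first by rewrite divr_gt0.
  by rewrite ler_pdivrMr // mul1r.
have H3 := ler_wpM2l (ltW (qk0 k)) H2.
have H4 := le_trans H (le_trans H3 gk).
have H5 := ler_wpM2l (ltW q0) H4.
have H6 := h_le s0; move: H5 H6 q1; move: (dilation_series _) (h s) => u v.
by lra.
Qed.

(* For [r = eta] this is the equality [dilation_series_rec]; in general, compare
   [s / (1 - r)] and [s] by means of a supporting line at [s / q]. *)
Lemma dilation_series_step s r : 0 < s -> eta <= r -> r < 1 ->
  (1 - r) * (eta * dilation_series (s / (1 - r))) + r * h s <= eta * dilation_series s.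
Proof.
move=> s0 er r1; have r0 : 0 < 1 - r by rewrite subr_gt0.
have sq0 : 0 < s / q by rewrite divr_gt0.
have [m hm] := concave_pos_support dilation_series_concave sq0.
have := hm _ (divr_gt0 s0 r0); have := hm _ s0.
have e := dilation_series_rec s0.
set G := dilation_series (s / q) in e *.
rewrite e; move: (h s) (dilation_series (s / (1 - r))) => x y H1 H2.
have e1 : q * (s / q) = s by rewrite mulrC divfK // gt_eqF.
have e2 : (1 - r) * (s / (1 - r)) = s by rewrite mulrC divfK // gt_eqF.
have qE : q = 1 - eta by [].
move: (s / q) (s / (1 - r)) e1 e2 H1 H2 => u v e1 e2 H1 H2.
have H1' : eta * (m * u) <= eta * G - x by move: H1; rewrite -e1 qE; nra.
have H2' : (1 - r) * y <= (1 - r) * G + m * u * (r - eta).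
  apply: le_trans (ler_wpM2l (ltW r0) H2) _; rewrite le_eqVlt; apply/orP; left.
  apply/eqP; rewrite mulrDr; congr (_ + _).
  by transitivity (m * ((1 - r) * v - (1 - r) * u)); [ring|rewrite e2 -e1 qE; ring].
have re0 : 0 <= r - eta by rewrite subr_ge0.
have H3 := ler_wpM2r re0 H1'; have H4 := ler_wpM2l (ltW eta_gt0) H2'.
rewrite mulrCA; apply: le_trans (lerD H4 (lexx _)) _.
rewrite -subr_ge0 qE.
have -> : eta * (x + (1 - eta) * G) - (eta * ((1 - r) * G + m * u * (r - eta)) + r * x) =
  (eta * G - x) * (r - eta) - eta * (m * u) * (r - eta) by ring.
by rewrite subr_ge0.
Qed.

End Integrable.
End SeriesFunctional.

(** * Comparison of the reciprocal sums with the series *)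

Section SeriesReciprocal.
Variables (R : realType) (h : R -> R) (lam : nat -> R) (eta : R).
Hypotheses (h_concave : concave_pos h)
  (h_nd : forall x y, 0 < x -> x <= y -> h x <= h y) (h1 : h 1 = 0).
Hypotheses (eta_gt0 : 0 < eta) (eta_lt1 : eta < 1).
Hypothesis lam_W0 : W0 lam.
Hypothesis lam_ge : forall n, eta <= lam n / partial_weight lam n.
Hypothesis lam_eta : lam n / partial_weight lam n @[n --> \oo] --> eta.
Let L := partial_weight lam.
Let L0 n : 0 < L n := partial_weight_gt0 lam_W0 n.
Let LS n : L n.+1 = L n + lam n.+1 := partial_weightS lam n.
Let q := 1 - eta.
Let q0 : 0 < q. Proof. by rewrite subr_gt0. Qed.
Let q1 : q < 1. Proof. by rewrite gtrBl. Qed.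
Let qk0 k : 0 < q ^+ k. Proof. exact: exprn_gt0. Qed.

Lemma reciprocal_sum_le_series : dilation_integrable h 1 ->
  forall s n, 0 < s -> reciprocal_sum lam h s n <= L n * (eta * dilation_series h eta s).
Proof.
move=> hi.
(* The numerator [s] stays fixed as [n] grows, so that the induction step is [dilation_series_step]
   with [r = lam n.+1 / L n.+1]. *)
have key n s : 0 < s -> \sum_(i < n.+1) lam i * h (s / L i) <=
    L n * (eta * dilation_series h eta (s / L n)).
  elim: n s => [|n IH] s s0; set G := dilation_series h eta.
    rewrite big_ord_recl big_ord0 addr0 -(partial_weight0 lam) /= ler_pM2l //.
    have sL : 0 < s / L 0 by rewrite divr_gt0.
    have := dilation_series_rec h_concave h_nd h1 eta_gt0 eta_lt1 hi sL.
    have : s / L 0 <= s / L 0 / q by rewrite ler_pdivlMr // ger_pMr // ltW.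
    move=> /(dilation_series_nd h_concave h_nd h1 eta_gt0 eta_lt1 hi sL).
    move=> /(ler_wpM2l (ltW q0)); rewrite /q -/G.
    by move: (G _) (G _) (h _) => u v w; lra.
  rewrite big_ord_recr /=; apply: le_trans (lerD (IH s s0) (lexx _)) _.
  set r := lam n.+1 / L n.+1.
  have rL : r * L n.+1 = lam n.+1 by rewrite divfK // gt_eqF.
  have LE : L n = (1 - r) * L n.+1 by rewrite mulrBl rL mul1r LS addrK.
  have r1 : r < 1 by rewrite ltr_pdivrMr // mul1r LS ltrDr.
  have sL : 0 < s / L n.+1 by rewrite divr_gt0.
  have := dilation_series_step h_concave h_nd h1 eta_gt0 eta_lt1 hi sL (lam_ge n.+1) r1.
  have -> : s / L n.+1 / (1 - r) = s / L n by rewrite LE invfM; ring.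
  move=> /(ler_wpM2l (ltW (L0 n.+1))); apply: le_trans; rewrite -/G -/r LE -rL.
  by rewrite le_eqVlt; apply/orP; left; apply/eqP; ring.
move=> s n s0; have sL : 0 < s * L n by rewrite mulr_gt0.
by have := key n _ sL; rewrite mulfK // gt_eqF.
Qed.

Let ratio_le n k : (k <= n)%N -> L (n - k) <= q ^+ k * L n.
Proof.
elim: k => [_|k IH kn]; first by rewrite subn0 expr0 mul1r.
have E : (n - k)%N = (n - k.+1).+1 by rewrite subnSK.
have le := lam_ge (n - k); rewrite -/L ler_pdivlMr // in le.
rewrite exprS -mulrA; apply: le_trans (ler_wpM2l (ltW q0) (IH (ltnW kn))).
by move: le; rewrite /q E LS; move: (L _) (lam _) => u v; lra.
Qed.

Let ratio_cvg k : L (n - k)%N / L n @[n --> \oo] --> q ^+ k.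
Proof.
elim: k => [|k IH].
  rewrite expr0 (_ : (fun n => _) = fun=> 1); first exact: cvg_cst.
  by apply/funext => n; rewrite subn0 divff // gt_eqF.
have c : (1 - lam (n - k)%N / L (n - k)%N) * (L (n - k)%N / L n) @[n --> \oo] --> q ^+ k.+1.
  rewrite exprS; apply: cvgM => //; apply: cvgB; first exact: cvg_cst.
  exact: (cvg_comp _ _ (cvg_subnr k) lam_eta).
(* The subtraction of naturals is truncated, so the recursion in [k] holds only for [k < n]. *)
apply: cvg_trans c; apply: near_eq_cvg; near=> n.
have kn : (k < n)%N by near: n; exact: nbhs_infty_gt.
have E : (n - k)%N = (n - k.+1).+1 by rewrite subnSK.
rewrite E; move: (n - k.+1)%N => m; rewrite LS; have := L0 m.+1; rewrite LS => Lm.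
by field; rewrite !gt_eqF.
Unshelve. all: by end_near. Qed.

Let weight_cvg k : lam (n - k)%N / L n @[n --> \oo] --> eta * q ^+ k.
Proof.
rewrite (_ : (fun n => _) = (fun n => (lam (n - k)%N / L (n - k)%N) * (L (n - k)%N / L n))).
  by apply: cvgM; last exact: ratio_cvg; exact: (cvg_comp _ _ (cvg_subnr k) lam_eta).
by apply/funext => n; field; rewrite !gt_eqF.
Qed.

(** Read the sum backwards from [n]. The weights [lam (n - k) / L n] tend to [eta * q ^+ k] and
    [L n / L (n - k) >= (q ^+ k)^-1], so the last [K] terms are eventually positive in total; the
    others are nonnegative since [q ^+ K <= s]. *)
Lemma reciprocal_sum_gt_series s K : 0 < s -> q ^+ K <= s ->
  0 < \sum_(k < K) dilation_term h eta s k ->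
  \forall n \near \oo, 0 < reciprocal_sum lam h s n.
Proof.
move=> s0 Ks pos.
have c : \sum_(k < K) lam (n - k)%N / L n * h (s / q ^+ k) @[n --> \oo] -->
    \sum_(k < K) eta * q ^+ k * h (s / q ^+ k).
  by apply: cvg_sum_ord => k; apply: cvgMl; exact: weight_cvg.
have pos' : 0 < \sum_(k < K) eta * q ^+ k * h (s / q ^+ k).
  under eq_bigr do rewrite -mulrA.
  by rewrite -mulr_sumr mulr_gt0.
have near_pos := cvgr_gt _ c 0 pos'.
near=> n.
have Kn : (K <= n)%N by near: n; exact: nbhs_infty_ge.
have npos : 0 < \sum_(k < K) lam (n - k)%N / L n * h (s / q ^+ k) by near: n; exact: near_pos.
have -> : reciprocal_sum lam h s n = \sum_(k < n.+1) lam (n - k)%N * h (s * L n / L (n - k)).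
  rewrite /reciprocal_sum (reindex_inj rev_ord_inj) /=.
  by apply: eq_bigr => i _; rewrite subSS.
have part m : (K <= m)%N -> (m <= n.+1)%N ->
    \sum_(k < K) lam (n - k)%N * h (s / q ^+ k) <=
    \sum_(k < m) lam (n - k)%N * h (s * L n / L (n - k)).
  have le k : (k <= n)%N -> h (s / q ^+ k) <= h (s * L n / L (n - k)).
    move=> kn; apply: h_nd; first by rewrite divr_gt0.
    rewrite -mulrA ler_pM2l // ler_pdivlMr // ler_pdivrMl //; exact: ratio_le.
  elim: m => [|m IH].
    by rewrite leqn0 => /eqP K0; rewrite K0 !big_ord0.
  rewrite leq_eqVlt => /predU1P[-> mn|Km mn].
    apply: ler_sum => k _; apply: ler_wpM2l; first exact: lam_ge0.
    by apply: le; rewrite -ltnS (leq_trans (ltn_ord k) mn).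
  rewrite ltnS in Km; rewrite [leRHS]big_ord_recr /=.
  apply: le_trans (IH Km (ltnW mn)) _; rewrite lerDl mulr_ge0 ?(lam_ge0 lam_W0) //.
  apply: le_trans (le m _); last by rewrite -ltnS.
  apply: (h_ge0 h_nd h1); rewrite ler_pdivlMr // mul1r; apply: le_trans Ks.
  by rewrite ler_wiXn2l // ltW.
apply: lt_le_trans (part n.+1 (leqW Kn) (leqnn _)).
have -> : \sum_(k < K) lam (n - k)%N * h (s / q ^+ k) =
    L n * \sum_(k < K) lam (n - k)%N / L n * h (s / q ^+ k).
  rewrite mulr_sumr; apply: eq_bigr => k _.
  by rewrite mulrA [L n * _]mulrC divfK // gt_eqF.
by rewrite mulr_gt0.
Unshelve. all: by end_near. Qed.

Lemma reciprocal_sum_nd s t n : 0 < s -> s <= t ->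
  reciprocal_sum lam h s n <= reciprocal_sum lam h t n.
Proof.
move=> s0 st; apply: ler_sum => i _; apply: ler_wpM2l; first exact: lam_ge0.
apply: h_nd; first by rewrite divr_gt0 // mulr_gt0.
by rewrite -!mulrA ler_pM2r // divr_gt0.
Qed.

(** By the previous lemma all long partial sums are nonpositive; hence the partial sums are bounded,
    which gives integrability, and their limit is nonpositive. *)
Lemma series_le0_of_reciprocal_sum s t : 0 < s -> s < t ->
  ~ (\forall n \near \oo, 0 < reciprocal_sum lam h t n) ->
  dilation_integrable h 1 /\ eta * dilation_series h eta s <= 0.
Proof.
move=> s0 st nT.
have [K0 hK0] := expr_small eta_gt0 eta_lt1 s0; rewrite -/q in hK0.
have le0 K : (K0 <= K)%N -> \sum_(k < K) dilation_term h eta s k <= 0.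
  move=> K0K; rewrite leNgt; apply/negP => pos; apply: nT.
  have Ks : q ^+ K <= s.
    by apply: le_trans hK0; rewrite ler_wiXn2l // ltW.
  apply: filterS (reciprocal_sum_gt_series s0 Ks pos) => n /lt_le_trans; apply.
  by apply: reciprocal_sum_nd => //; exact: ltW.
have bnd K : \sum_(k < K) dilation_term h eta s k <= \sum_(k < K0) `|dilation_term h eta s k|.
  have [K0K|KK0] := leqP K0 K; first by rewrite (le_trans (le0 K K0K)) // sumr_ge0.
  apply: (@le_trans _ _ (\sum_(k < K) `|dilation_term h eta s k|)).
    by apply: ler_sum => k _; exact: ler_norm.
  apply: (@homo_leq _ (fun m => \sum_(k < m) `|dilation_term h eta s k|) <=%R) (ltnW KK0) => //.
    by move=> y x z; exact: le_trans.
  by move=> m; rewrite big_ord_recr lerDl normr_ge0.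
have si := dilation_integrable_partial_sums h_nd h1 eta_gt0 eta_lt1 s0 bnd.
split; first exact: (dilation_integrable_transfer h_concave h_nd h1 s0 ltr01 si).
rewrite pmulr_rle0 //; apply: limr_le; first exact: dilation_series_cvg.
by exists K0 => // n /= hn; rewrite /series /= big_mkord; exact: le0.
Qed.

End SeriesReciprocal.

(** * The Hardy criterion *)

Section Criterion.
Variables (R : realType) (I : set R) (E : R -> R -> R) (lam : nat -> R).
Hypotheses (I_itv : is_interval I) (I_neq0 : I !=set0).
Hypotheses (I_pos : forall x, I x -> 0 < x) (I_inf : inf I = 0).
Hypotheses (lam_W0 : W0 lam)
  (lam_mono : nonincreasing_seq (fun n => lam n / partial_weight lam n))
  (lam_oo : partial_weight lam n @[n --> \oo] --> +oo).
Hypotheses (E_qdev : quasideviation I E) (E_norm : normalizable I E).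
Hypothesis E_concave : concave_on_square I (normalization I E).
Hypothesis E_lim0 : forall x : R, 0 < x ->
  normalization I E (x * t) t @[t --> 0^'+] --> 0.
Let h := h_fun I E.
Let M := quasidev_mean I E.

Let hardy_ineq_le (C C' : \bar R) :
  hardy_inequality I lam M C -> (C <= C')%E -> hardy_inequality I lam M C'.
Proof.
move=> hC CC' x Ix; apply: (le_trans (hC x Ix)); apply: lee_wpmul2r => //.
apply: nneseries_ge0 => n _ _; rewrite lee_fin mulr_ge0 ?(lam_ge0 lam_W0) //.
by rewrite ltW // I_pos.
Qed.

Let constant_ge (b r : R) : 0 < b -> hardy_inequality I lam M r%:E ->
  (\forall n \near \oo, 0 < reciprocal_sum lam h b^-1 n) -> b <= r.
Proof.
move=> b0 hr hT.
have m0 : 0 <= Num.max r 0 by rewrite le_max lexx orbT.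
have hm : hardy_inequality I lam M (Num.max r 0)%:E.
  by apply: (hardy_ineq_le hr); rewrite lee_fin le_max lexx.
have := hardy_constant_ge I_itv I_neq0 I_pos I_inf lam_W0 lam_oo E_qdev E_norm
  E_concave E_lim0 b0 m0 hm hT.
by rewrite le_max => /orP[//|]; rewrite leNgt b0.
Qed.

(** Treats both cases of [eta] at once: [S] will be integrability, and [G] the integral or [eta]
    times the series. Since [G] makes sense only under [S], the last hypothesis must deliver [S]
    itself. *)
Lemma hardy_criterion (S : Prop) (G : R -> R) :
  (S -> concave_pos G) ->
  (S -> forall s t, 0 < s -> s <= t -> G s <= G t) ->
  (S -> forall s n, 0 < s -> reciprocal_sum lam h s n <= partial_weight lam n * G s) ->
  (S -> exists2 a, 0 < a & G a < 0) ->
  (forall s t, 0 < s -> s < t ->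
     ~ (\forall n \near \oo, 0 < reciprocal_sum lam h t n) -> S /\ G s <= 0) ->
  (is_hardy I lam M <-> S) /\
  (S -> exists c, [/\ 0 < c, is_hardy_constant I lam M c%:E, G c^-1 = 0 &
     forall c', 0 < c' -> G c'^-1 = 0 -> c' = c]).
Proof.
move=> Gc Gnd GU Gneg GL.
have L0 := partial_weight_gt0 lam_W0.
have sol : S -> exists c, [/\ 0 < c, is_hardy_constant I lam M c%:E, G c^-1 = 0 &
     forall c', 0 < c' -> G c'^-1 = 0 -> c' = c].
  move=> HS; have [a a0 Ga] := Gneg HS.
  (* The single term of [T 2 0] is [lam 0 * h 2 > 0]. *)
  have G2 : 0 < G 2.
    rewrite -(pmulr_rgt0 _ (L0 0)); apply: lt_le_trans (GU HS 2 0%N _) => //.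
    rewrite /reciprocal_sum big_ord_recl big_ord0 addr0 mulfK ?gt_eqF //.
    rewrite mulr_gt0 ?lam_W0.1 //.
    apply: (h_fun_gt0 I_itv I_neq0 I_pos I_inf E_qdev E_norm E_concave E_lim0).
    by rewrite ltr1n.
  have [s [s0 Gs Gs_lt Gs_gt]] := concave_pos_zero (Gc HS) (Gnd HS) a0 Ga (ltr0Sn R 1) G2.
  exists s^-1; split.
  - by rewrite invr_gt0.
  - split.
      exact: (quasidev_mean_hardy I_itv I_neq0 I_pos I_inf lam_W0 lam_mono E_qdev
        E_norm E_concave E_lim0 (GU HS) s0 Gs_lt).
    have lb r : hardy_inequality I lam M r%:E -> s^-1 <= r.
      move=> hr; rewrite leNgt; apply/negP => rs.
      pose m := Num.max r 0.
      have mC : m < s^-1 by rewrite gt_max rs invr_gt0 s0.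
      have m0 : 0 <= m by rewrite le_max lexx orbT.
      (* An admissible [r < s^-1] leaves room for [b] with [m < b < s^-1] and for [u] with
         [s < u < b^-1]. As [b > r], [T b^-1 n] is not eventually positive, so [G u <= 0], although
         [u > s]. *)
      pose b := (m + s^-1) / 2.
      have mb : m < b by rewrite /b; lra.
      have bs : b < s^-1 by rewrite /b; lra.
      have b0 : 0 < b by exact: le_lt_trans mb.
      have sb : s < b^-1 by rewrite -[s]invrK ltf_pV2 ?posrE ?invr_gt0.
      pose u := (s + b^-1) / 2.
      have su : s < u by rewrite /u; lra.
      have ub : u < b^-1 by rewrite /u; lra.
      have := Gs_gt u su; apply/negP; rewrite -leNgt.
      suff [] : S /\ G u <= 0 by [].
      apply: (GL u b^-1 (lt_trans s0 su) ub) => hT.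
      have := constant_ge b0 hr hT.
      by apply/negP; rewrite -ltNge (le_lt_trans _ mb) // le_max lexx.
    move=> [r| |] hC; rewrite ?leey //; first by rewrite lee_fin; exact: lb.
    have := lb 0 (hardy_ineq_le hC (leNye _)).
    by rewrite leNgt invr_gt0 s0.
  - by rewrite invrK.
  move=> c' c'0 Gc'; rewrite -[c']invrK; congr (_^-1); apply/eqP.
  have i0 : 0 < c'^-1 by rewrite invr_gt0.
  case: (ltgtP c'^-1 s) => // cs.
    by have := Gs_lt _ i0 cs; rewrite Gc' ltxx.
  by have := Gs_gt _ cs; rewrite Gc' ltxx.
split=> //; split=> [[C [hC _] Coo]|HS]; last first.
  by have [c [_ hc _ _]] := sol HS; exists c%:E; rewrite ?ltry.
(* A finite nonnegative constant dominating [C], also for [C = -oo]. Since [r + 1 > r], the sums at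
   [(r + 1)^-1] are not eventually positive, which yields [S]. *)
pose r := Num.max (fine C) 0.
have hr : hardy_inequality I lam M r%:E.
  apply: (hardy_ineq_le hC); case: C hC Coo @r => [x| |] //= _ _.
    by rewrite lee_fin le_max lexx.
  by rewrite leNye.
have r0 : 0 <= r by rewrite le_max lexx orbT.
have b0 : 0 < r + 1 by rewrite ltr_wpDl.
have t0 : 0 < (r + 1)^-1 by rewrite invr_gt0.
have t1 : 0 < (r + 1)^-1 / 2 by lra.
have t2 : (r + 1)^-1 / 2 < (r + 1)^-1 by lra.
suff [] : S /\ G ((r + 1)^-1 / 2) <= 0 by [].
apply: (GL _ _ t1 t2) => hT; have := constant_ge b0 hr hT.
by rewrite gerDl ler10.
Qed.

End Criterion.

Theorem theorem5p5 (R : realType) (I : set R) (E : R -> R -> R)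
    (lam : nat -> R) (eta : R)
    (I_itv : is_interval I) (I_neq0 : I !=set0)
    (I_pos : forall x, I x -> 0 < x) (I_inf : inf I = 0)
    (lam_W0 : W0 lam)
    (lam_oo : partial_weight lam n @[n --> \oo] --> +oo)
    (lam_mono : nonincreasing_seq (fun n => lam n / partial_weight lam n))
    (lam_eta : lam n / partial_weight lam n @[n --> \oo] --> eta)
    (eta_ge0 : 0 <= eta) (eta_lt1 : eta < 1)
    (E_qdev : quasideviation I E) (E_norm : normalizable I E)
    (E_concave : concave_on_square I (normalization I E))
    (E_lim0 : forall x : R, 0 < x ->
       normalization I E (x * t) t @[t --> 0^'+] --> 0) :
  (is_hardy I lam (quasidev_mean I E) <->
   lebesgue_measure.-integrable `]0, 1] (fun x : R => (h_fun I E x^-1)%:E)) /\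
  (is_hardy I lam (quasidev_mean I E) ->
   exists c : R,
     [/\ 0 < c,
         is_hardy_constant I lam (quasidev_mean I E) c%:E,
         hardy_equation eta (h_fun I E) c
       & forall c' : R, 0 < c' -> hardy_equation eta (h_fun I E) c' -> c' = c]).
Proof.
pose h := h_fun I E.
have h_conc : concave_pos h.
  exact: (h_fun_concave I_itv I_neq0 I_pos I_inf E_qdev E_norm E_concave E_lim0).
have h_nd x y : 0 < x -> x <= y -> h x <= h y.
  exact: (h_fun_nd I_itv I_neq0 I_pos I_inf E_qdev E_norm E_concave E_lim0).
have h1 : h 1 = 0 by exact: (h_fun1 I_itv I_neq0 I_pos I_inf E_qdev E_norm).
have h_le x : 0 < x -> h x <= x - 1.
  exact: (h_fun_le I_itv I_neq0 I_pos I_inf E_qdev E_norm E_concave E_lim0).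
have -> : (fun x : R => (h_fun I E x^-1)%:E) = EFin \o (fun x => h (1 / x)).
  by apply/funext => x /=; rewrite div1r.
suff [G [crit eqG]] : exists G : R -> R,
    ((is_hardy I lam (quasidev_mean I E) <-> dilation_integrable h 1) /\
      (dilation_integrable h 1 -> exists c, [/\ 0 < c,
         is_hardy_constant I lam (quasidev_mean I E) c%:E, G c^-1 = 0 &
         forall c', 0 < c' -> G c'^-1 = 0 -> c' = c])) /\
    (dilation_integrable h 1 -> forall c, 0 < c ->
      hardy_equation eta h c <-> G c^-1 = 0).
  have [iff sol] := crit; split=> // /iff hi.
  have [c [c0 hc Gc uniq]] := sol hi; exists c; split=> //.
    exact/(eqG hi c c0).
  by move=> c' c'0 /(eqG hi c' c'0); exact: uniq.
have [eta0|eta0] := eqVneq eta 0.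
  rewrite eta0 in lam_eta *.
  exists (dilation_integral h); split.
    apply: (hardy_criterion I_itv I_neq0 I_pos I_inf lam_W0 lam_mono lam_oo
      E_qdev E_norm E_concave E_lim0).
    - exact: dilation_integral_concave.
    - exact: dilation_integral_nd.
    - exact: reciprocal_sum_le_integral.
    - exact: dilation_integral_lt0.
    - exact: integral_le0_of_reciprocal_sum.
  move=> hi c c0; rewrite /hardy_equation eqxx.
  have ci : 0 < c^-1 by rewrite invr_gt0.
  have si := dilation_integrable_transfer h_conc h_nd h1 ltr01 ci hi.
  have -> : (fun x => (h (c * x)^-1)%:E) = EFin \o (fun x => h (c^-1 / x)).
    by apply/funext => x /=; rewrite invfM.
  have m01 : measurable (`]0, 1]%classic : set (measurableTypeR R)) by exact: measurable_itv.
  (* [fine] sends infinite values to 0, so a vanishing real integral gives the extended equation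
     only once finiteness is known. *)
  have fin := integrable_fin_num m01 si.
  rewrite /dilation_integral /Rintegral; split=> [->//|H].
  by rewrite -(fineK fin); congr (_%:E).
have eta_gt0 : 0 < eta by rewrite lt_neqAle eq_sym eta0.
have lam_ge n : eta <= lam n / partial_weight lam n.
  rewrite -(cvg_lim (@Rhausdorff R) lam_eta); apply: nonincreasing_cvgn_ge => //.
  by apply/cvg_ex; exists eta.
exists (fun s => eta * dilation_series h eta s); split.
  apply: (hardy_criterion I_itv I_neq0 I_pos I_inf lam_W0 lam_mono lam_oo
    E_qdev E_norm E_concave E_lim0 (G := fun s => eta * dilation_series h eta s)).
  - move=> hi x y t x0 y0 t0 t1; rewrite !(mulrCA _ eta) -mulrDr ler_pM2l //.
    exact: (dilation_series_concave h_conc h_nd h1 eta_gt0 eta_lt1 hi).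
  - move=> hi s t s0 st; rewrite ler_pM2l //.
    exact: (dilation_series_nd h_conc h_nd h1 eta_gt0 eta_lt1 hi).
  - exact: reciprocal_sum_le_series.
  - move=> hi; have [a a0 Ga] := dilation_series_lt0 h_conc h_nd h1 h_le eta_gt0 eta_lt1 hi.
    by exists a => //; rewrite pmulr_rlt0.
  - exact: series_le0_of_reciprocal_sum.
move=> hi c c0; rewrite /hardy_equation (negbTE eta0).
have ci : 0 < c^-1 by rewrite invr_gt0.
have si := dilation_integrable_transfer h_conc h_nd h1 ltr01 ci hi.
have cv := dilation_series_cvg h_nd eta_gt0 eta_lt1 ci si.
have -> : (fun k => (1 - eta) ^+ k * h (c * (1 - eta) ^+ k)^-1) = dilation_term h eta c^-1.
  by apply/funext => k; rewrite /dilation_term invfM.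
(* Conversely, a zero value of [limn] means convergence to 0 only because the series is known to
   converge, by [cv]. *)
split=> [c0'|/eqP]; first by rewrite /dilation_series (cvg_lim (@Rhausdorff R) c0') mulr0.
rewrite mulf_eq0 (negbTE eta0) => /eqP /= <-; exact: cv.
Qed.
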